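(* Let $n\geq 1$ and let $\mathrm{Aut}^0_{\mathrm{hol}}(\mathbb C^n)$ be the set of biholomorphic maps $F:\mathbb C^n\to\mathbb C^n$ with $F(0)=0$ and $DF(0)=I$. The map $\mathfrak{X}^n_0:\mathrm{Aut}^0_{\mathrm{hol}}(\mathbb C^n)\to\mathfrak{L}^n(PSH)$, $\mathfrak{X}^n_0(F)=L(\log\|F\|)$ (the Levi matrix of $z\mapsto\log\|F(z)\|$ on $\mathbb C^n\setminus\{0\}$), is injective. Equivalently, if $F,G\in \mathrm{Aut}^0_{\mathrm{hol}}(\mathbb C^n)$ and $\log\|F\|-\log\|G\|$ is pluriharmonic on $\mathbb C^n\setminus\{0\}$, then $F=G$.
   Context: $\|\cdot\|$ is the standard Hermitian norm on $\mathbb C^n$. For a real-valued $C^2$ function $g$ on an open subset of $\mathbb C^n$, its Levi matrix is $L(g)=\big(\partial^2 g/\partial z_i\partial\bar z_j\big)_{i,j}$; $g$ is plurisubharmonic if $L(g)\ge0$ and pluriharmonic if $L(g)=0$ everywhere. $\mathfrak{L}^n(PSH)$ denotes the set of Levi matrices of real-analytic plurisubharmonic functions on $\mathbb C^n\setminus\{0\}$. *)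

(* Defs.v *)
From mathcomp Require Import all_boot all_order all_algebra.
From mathcomp Require Import all_classical all_reals all_analysis.
From mathcomp Require Import complex.
Set Implicit Arguments. Unset Strict Implicit. Unset Printing Implicit Defensive.
Import Order.TTheory GRing.Theory Num.Theory numFieldNormedType.Exports.
Local Open Scope classical_set_scope.
Local Open Scope ring_scope.

(* the space C^n, as real normed space R^n x R^n (real part, imaginary part) *)
Notation Cn R n := ('rV[R]_n * 'rV[R]_n)%type.

Section Defs.
Variable R : realType.
Variable n : nat.

Definition ex (j : 'I_n) : Cn R n := (delta_mx 0 j, 0).
Definition ey (j : 'I_n) : Cn R n := (0, delta_mx 0 j).

Definition mulI (w : Cn R n) : Cn R n := (- w.2, w.1).

(* F : C^n -> C^n holomorphic: real differentiable everywhere with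
   complex-linear differential (Cauchy-Riemann: dF/dy_j = i dF/dx_j) *)
Definition holomorphic (F : Cn R n -> Cn R n) : Prop :=
  forall z, differentiable F z /\
    forall j, 'D_(ey j) F z = mulI ('D_(ex j) F z).

Definition biholomorphic (F : Cn R n -> Cn R n) : Prop :=
  holomorphic F /\
  exists G : Cn R n -> Cn R n, holomorphic G /\ cancel F G /\ cancel G F.

Definition Aut0 (F : Cn R n -> Cn R n) : Prop :=
  biholomorphic F /\ F 0 = 0 /\ forall v, 'd F 0 v = v.

Definition hnorm (z : Cn R n) : R :=
  Num.sqrt (\sum_(k < n) (z.1 0 k ^+ 2 + z.2 0 k ^+ 2)).

Definition dX (j : 'I_n) (g : Cn R n -> R) : Cn R n -> R :=
  fun z => 'D_(ex j) g z.
Definition dY (j : 'I_n) (g : Cn R n -> R) : Cn R n -> R :=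
  fun z => 'D_(ey j) g z.

Definition coord_dir (u : Cn R n) : Prop := exists j, u = ex j \/ u = ey j.

Definition C2_on (U : set (Cn R n)) (g : Cn R n -> R) : Prop :=
  forall z, U z ->
    {for z, continuous g} /\
    forall u v, coord_dir u -> coord_dir v ->
      [/\ derivable g z u, {for z, continuous ('D_u g)},
          derivable ('D_u g) z v & {for z, continuous ('D_v ('D_u g))}].

(* Levi matrix L(g)_{ij} = d^2 g / dz_i d zbar_j, with the Wirtinger
   operators d/dz_i = (d/dx_i - i d/dy_i)/2, d/dzbar_j = (d/dx_j + i d/dy_j)/2 *)
Definition levi (g : Cn R n -> R) (z : Cn R n) : 'M[R[i]]_n :=
  \matrix_(i < n, j < n)
    Complex ((dX i (dX j g) z + dY i (dY j g) z) / 4)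
            ((dX i (dY j g) z - dY i (dX j g) z) / 4).

Definition pluriharmonic_on (U : set (Cn R n)) (g : Cn R n -> R) : Prop :=
  open U /\ C2_on U g /\ forall z, U z -> levi g z = 0.

End Defs.

(* Main.v *)
From HB Require Import structures.
Require Import Defs.
From mathcomp Require Import all_boot all_order all_algebra.
From mathcomp Require Import all_classical all_reals all_analysis.
From mathcomp Require Import complex ring lra.
Import Order.TTheory GRing.Theory Num.Theory numFieldNormedType.Exports.
Local Open Scope classical_set_scope.
Local Open Scope ring_scope.
Set Implicit Arguments. Unset Strict Implicit. Unset Printing Implicit Defensive.

(** Put [Phi = F \o G^-1]. The Levi form of [ln |F|] is the pullback by [F] of
    the Fubini-Study form, so it vanishes on [v] exactly when ['d F z v] is a
    complex multiple of [F z]. For [v = 'd G^-1 w w] this happens for [G], hence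
    also for [F], i.e. ['d Phi w w] is a multiple of [Phi w]. So along each ray
    the complex direction of [Phi] is constant, and since ['d Phi 0] is the
    identity it is that of the ray: [Phi] maps every complex line through [0] to
    itself. On such a line [Phi] is a proper entire function [f] vanishing only
    at [0], with [f' 0 = 1]; then [t^2 / f t] is entire and [o(|t|^2)], so by
    Liouville it is affine, and [f t = t].

    Holomorphic functions are only assumed differentiable, so their smoothness
    comes from Goursat's theorem, which yields Cauchy's formula for the first
    derivative. *)

(** * Goursat's theorem and Cauchy's formula *)

Section SegmentIntegral.
Context {R : realType}.
Implicit Types (a b c k M : R) (f g : R -> R).
Local Notation mu := (@lebesgue_measure R).

(** Everything is done over the reals: a holomorphic function is a pair [u], [v] on a real normed
    space with an operator [J] standing for multiplication by i. One form of Cauchy's formula then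
    serves both [Cn] with [mulI] and the plane with [quarter_turn]. The formula expresses the
    differential of [u] as a mean of [u] and [v] over a circle, so a differential is as regular as
    the function; this is why the second derivatives in the Levi matrix exist. The growth of f is
    not known, only that |f| tends to infinity, so Liouville's theorem is applied to a quotient with
    f in the denominator. The numerator t^2 makes this quotient differentiable at 0 from f t = t +
    o(t) alone, since t^2 / f t - t = t (t - f t) / f t; with numerator t a second-order expansion
    would be required. The price is growth o(|t|^2) instead of o(|t|), hence a Liouville theorem for
    subquadratic growth. *)

Definition segint a b f : R := \int[mu]_(x in `[a, b]) f x.

Lemma segint_integrable a b f :
  continuous f -> mu.-integrable `[a, b] (EFin \o f).
Proof.
move=> cf; apply: continuous_compact_integrable; first exact: segment_compact.
exact: continuous_subspaceT.
Qed.

Lemma segintB a b f g : continuous f -> continuous g ->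
  segint a b (fun x => f x - g x) = segint a b f - segint a b g.
Proof. by move=> cf cg; apply: RintegralB => //; apply: segint_integrable. Qed.

Lemma segintD a b f g : continuous f -> continuous g ->
  segint a b (fun x => f x + g x) = segint a b f + segint a b g.
Proof. by move=> cf cg; apply: RintegralD => //; apply: segint_integrable. Qed.

Lemma segintZ a b k f : continuous f ->
  segint a b (fun x => k * f x) = k * segint a b f.
Proof. by move=> cf; apply: RintegralZl => //; apply: segint_integrable. Qed.

Lemma eq_segint a b f g : f =1 g -> segint a b f = segint a b g.
Proof. by move=> fg; apply: eq_Rintegral => x _. Qed.

Lemma segint_cst a b k : a <= b -> segint a b (fun=> k) = k * (b - a).
Proof.
move=> ab; rewrite /segint Rintegral_cst //= lebesgue_measure_itv /= lte_fin.
by case: ltgtP ab => //= -> _; rewrite subrr.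
Qed.

Lemma segint_cat a b c f : a <= b -> b <= c -> continuous f ->
  segint a c f = segint a b f + segint b c f.
Proof.
move=> ab bc cf; rewrite /segint.
have if_ := @segint_integrable a c f cf.
have := @Rintegral_itvB R f (BLeft a) (BRight c) b if_.
rewrite !bnd_simp => /(_ ab bc) h.
rewrite -(@Rintegral_itv_obnd_cbnd R b (BRight c)); last first.
  apply: integrableS (@segint_integrable b c f cf) => //.
  by apply: subset_itvr; rewrite bnd_simp.
by rewrite -h addrC subrK.
Qed.

(** The estimate used both for Goursat's local bound and for shrinking circles: the integrand is
    compared with a constant coming from a linearization. *)
Lemma segint_approx a b k M f : a <= b -> continuous f ->
  (forall x, a <= x <= b -> `|f x - k| <= M) ->
  `|segint a b f - k * (b - a)| <= M * (b - a).
Proof.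
move=> ab cf fM.
have cfk : continuous (fun x => f x - k).
  by move=> x; apply: continuousB; [exact: cf|exact: cst_continuous].
rewrite -segint_cst // -segintB //; last exact: cst_continuous.
have nf : continuous (fun x => `|f x - k|).
  by move=> x; apply: cvg_norm; exact: cfk.
rewrite -segint_cst //; apply: le_trans (le_normr_Rintegral _ _) _ => //.
  exact: segint_integrable.
apply: le_Rintegral => //; apply: segint_integrable => //.
exact: cst_continuous.
Qed.

Lemma segint_norm_le a b M f : a <= b -> continuous f ->
  (forall x, a <= x <= b -> `|f x| <= M) -> `|segint a b f| <= M * (b - a).
Proof.
move=> ab cf fM; have := @segint_approx a b 0 M f ab cf.
by rewrite mul0r subr0; apply => x /fM; rewrite subr0.
Qed.

Lemma segint_FTC a b (F f : R -> R) : a < b -> continuous f ->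
  (forall x : R, is_derive x (1 : R) F (f x)) -> segint a b f = F b - F a.
Proof.
move=> ab cf dF; rewrite /segint /Rintegral (@continuous_FTC2 _ f F) //.
- exact: continuous_subspaceT.
- have cF : continuous F.
    move=> x; apply/differentiable_continuous/derivable1_diffP.
    by have [] := dF x.
  split.
  + by move=> x _; have [] := dF x.
  + by apply: cvg_at_right_filter; exact: cF.
  + by apply: cvg_at_left_filter; exact: cF.
- by move=> x _; rewrite derive1E; have [] := dF x.
Qed.

End SegmentIntegral.

(** * Goursat's theorem for closed forms on rectangles *)

Section Goursat.
Context {R : realType}.

(** An interval is given by its left end [u n] and its length [l n]; the common point is the
    supremum of the left ends. *)
Lemma nested_segments (u l : nat -> R) :
  (forall n, u n <= u n.+1) -> (forall n, u n.+1 + l n.+1 <= u n + l n) ->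
  (forall n, 0 <= l n) -> exists x, forall n, u n <= x <= u n + l n.
Proof.
move=> uS ulS l0.
have umono m n : (m <= n)%N -> u m <= u n.
  elim: n => [|n ih]; first by rewrite leqn0 => /eqP ->.
  rewrite leq_eqVlt ltnS => /predU1P[-> //|/ih umn]; exact: le_trans umn (uS n).
have ulmono m n : (m <= n)%N -> u n + l n <= u m + l m.
  elim: n => [|n ih]; first by rewrite leqn0 => /eqP ->.
  rewrite leq_eqVlt ltnS => /predU1P[-> //|/ih]; exact: le_trans (ulS n).
have uub m n : u m <= u n + l n.
  apply: le_trans (umono _ _ (leq_maxl m n)) _.
  by apply: le_trans (ulmono _ _ (leq_maxr m n)); rewrite lerDl.
exists (sup (range u)) => n; apply/andP; split.
  by apply: ub_le_sup; [exists (u 0 + l 0) => _ [m _ <-]|exists n].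
by apply: ge_sup; [exists (u 0); exists 0|move=> _ [m _ <-]].
Qed.

(** Goursat's subdivision, separated from integration. If [T] failed on a rectangle it would fail on
    one of its quarters, and so on down a nested sequence shrinking to a point (p, q), against the
    local hypothesis there. *)
Lemma rectangle_bisection (T : R -> R -> R -> R -> Prop) :
  (forall x y w h : R, 0 <= w -> 0 <= h ->
    T x y (w / 2) (h / 2) -> T (x + w / 2) y (w / 2) (h / 2) ->
    T x (y + h / 2) (w / 2) (h / 2) ->
    T (x + w / 2) (y + h / 2) (w / 2) (h / 2) -> T x y w h) ->
  (forall p q : R, exists2 d, 0 < d & forall x y w h, 0 <= w < d -> 0 <= h < d ->
    x <= p <= x + w -> y <= q <= y + h -> T x y w h) ->
  forall x y w h, 0 <= w -> 0 <= h -> T x y w h.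
Proof.
move=> Tsplit Tloc x y w h w0 h0; apply: contrapT => nT.
pose wn n := w / 2 ^+ n; pose hn n := h / 2 ^+ n.
have wnS n : wn n.+1 = wn n / 2 by rewrite /wn exprSr invfM mulrA.
have hnS n : hn n.+1 = hn n / 2 by rewrite /hn exprSr invfM mulrA.
have wn0 n : 0 <= wn n by rewrite divr_ge0 // exprn_ge0.
have hn0 n : 0 <= hn n by rewrite divr_ge0 // exprn_ge0.
pose bad n (c : R * R) := ~ T c.1 c.2 (wn n) (hn n).
(* Badness of [c] is a premise under the existential, so that a choice is defined for every corner
   and the sequence is a plain recursion. *)
have step n c : exists c' : R * R, bad n c -> [/\ bad n.+1 c',
    c'.1 = c.1 \/ c'.1 = c.1 + wn n / 2 & c'.2 = c.2 \/ c'.2 = c.2 + hn n / 2].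
  case: (pselect (bad n c)) => [bc|]; last by exists c.
  apply: contrapT => /forallNP nex; apply: bc.
  have ok c' : c'.1 = c.1 \/ c'.1 = c.1 + wn n / 2 ->
      c'.2 = c.2 \/ c'.2 = c.2 + hn n / 2 -> T c'.1 c'.2 (wn n / 2) (hn n / 2).
    move=> c1 c2; apply: contrapT => bc'; apply: (nex c') => _.
    by split=> //; rewrite /bad wnS hnS.
  apply: Tsplit => //.
  - by apply: (ok (_, _)); left.
  - by apply: (ok (_, _)); [right|left].
  - by apply: (ok (_, _)); [left|right].
  - by apply: (ok (_, _)); right.
pose next n c := sval (cid (step n c)).
pose f := fix f n := if n is m.+1 then next m (f m) else (x, y).
have fbad n : bad n (f n).
  elim: n => [|n ih]; first by rewrite /bad /wn /hn expr0 !divr1.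
  by rewrite /= /next; case: cid => c' /= /(_ ih) [].
have fS n : (f n.+1).1 = (f n).1 \/ (f n.+1).1 = (f n).1 + wn n / 2.
  by rewrite /= /next; case: cid => c' /= /(_ (fbad n)) [].
have gS n : (f n.+1).2 = (f n).2 \/ (f n.+1).2 = (f n).2 + hn n / 2.
  by rewrite /= /next; case: cid => c' /= /(_ (fbad n)) [].
have [p pP] : exists p, forall n, (f n).1 <= p <= (f n).1 + wn n.
  apply: (@nested_segments (fun n => (f n).1)) => // n;
    have := wn0 n; rewrite ?wnS; case: (fS n) => ->; lra.
have [q qP] : exists q, forall n, (f n).2 <= q <= (f n).2 + hn n.
  apply: (@nested_segments (fun n => (f n).2)) => // n;
    have := hn0 n; rewrite ?hnS; case: (gS n) => ->; lra.
have [d d0 dT] := Tloc p q.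
have small v : 0 <= v -> exists m, forall n, (m <= n)%N -> v / 2 ^+ n < d.
  move=> v0; exists (Num.bound (v / d)) => n mn.
  rewrite ltr_pdivrMr ?exprn_gt0 // mulrC -ltr_pdivrMr //.
  apply: lt_le_trans (archi_boundP _) _; first by rewrite divr_ge0 // ltW.
  rewrite -natrX ler_nat; apply: leq_trans mn _; exact/ltnW/ltn_expl.
have [m1 m1P] := small w w0; have [m2 m2P] := small h h0.
apply: (fbad (maxn m1 m2)); apply: dT => //.
- by rewrite wn0 m1P // leq_maxl.
- by rewrite hn0 m2P // leq_maxr.
Qed.

Lemma differentiable_approx (V W : normedModType R) (f : V -> W) z :
  differentiable f z -> forall e, 0 < e -> exists2 d, 0 < d &
    forall k, `|k| < d -> `|f (z + k) - f z - 'd f z k| <= e * `|k|.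
Proof.
move=> df e e0; have /eqaddoP /(_ e e0) := diff_locally df.
move=> /nbhs_normP [d /= d0 dP]; exists d => // k kd.
have := dP k; rewrite /= sub0r normrN => /(_ kd).
by rewrite -[_ - _ - _]addrA -opprD [z + k]addrC.
Qed.

Variables P Q : R * R -> R.
Hypothesis dP : forall z, differentiable P z.
Hypothesis dQ : forall z, differentiable Q z.
Hypothesis closedPQ : forall z, 'd P z (0, 1) = 'd Q z (1, 0).

Let cP : continuous P. Proof. by move=> z; apply: differentiable_continuous. Qed.
Let cQ : continuous Q. Proof. by move=> z; apply: differentiable_continuous. Qed.

Let cP1 y : continuous (fun t => P (t, y)).
Proof.
move=> t; apply: differentiable_continuous.
apply: (@differentiable_comp _ _ _ _ (fun t : R => (t, y)) P) => //.
Qed.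

Let cQ2 x : continuous (fun t => Q (x, t)).
Proof.
move=> t; apply: differentiable_continuous.
apply: (@differentiable_comp _ _ _ _ (fun t : R => (x, t)) Q) => //.
Qed.

(** Integral of P dx + Q dy along the boundary of the rectangle with corner (x, y), anticlockwise,
    opposite sides being grouped. *)
Let loop (x y w h : R) := segint x (x + w) (fun t => P (t, y) - P (t, y + h)) +
  segint y (y + h) (fun t => Q (x + w, t) - Q (x, t)).

Let loop_split1 (x y w1 w2 h : R) : 0 <= w1 -> 0 <= w2 ->
  loop x y (w1 + w2) h = loop x y w1 h + loop (x + w1) y w2 h.
Proof.
move=> w10 w20; rewrite /loop !segintB // !addrA.
by rewrite !(@segint_cat _ x (x + w1) (x + w1 + w2)) ?lerDl //; ring.
Qed.

Let loop_split2 (x y w h1 h2 : R) : 0 <= h1 -> 0 <= h2 ->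
  loop x y w (h1 + h2) = loop x y w h1 + loop x (y + h1) w h2.
Proof.
move=> h10 h20; rewrite /loop !segintB // !addrA.
by rewrite !(@segint_cat _ y (y + h1) (y + h1 + h2)) ?lerDl //; ring.
Qed.

(** The loop integral of the affine approximation at (p, q) vanishes because the form is closed.
    What is left is an error of at most [e * (w + h)] in each grouped integrand, over lengths [w]
    and [h]. *)
Let loop_local (e : R) : 0 < e -> forall p q : R, exists2 d, 0 < d &
  forall x y w h : R, 0 <= w < d -> 0 <= h < d -> x <= p <= x + w ->
    y <= q <= y + h -> `|loop x y w h| <= e * (w + h) ^+ 2.
Proof.
move=> e0 p q; have e20 : 0 < e / 2 by rewrite divr_gt0.
have [d1 d10 d1P] := differentiable_approx (dP (p, q)) e20.
have [d2 d20 d2P] := differentiable_approx (dQ (p, q)) e20.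
exists (Num.min d1 d2); first by rewrite lt_min d10.
move=> x y w h /andP[w0]; rewrite lt_min => /andP[wd1 wd2].
move=> /andP[h0]; rewrite lt_min => /andP[hd1 hd2] /andP[xp pw] /andP[yq qh].
have nrm s t : x <= s <= x + w -> y <= t <= y + h ->
    [/\ `|(s - p, t - q)| < d1, `|(s - p, t - q)| < d2 &
        `|(s - p, t - q)| <= w + h].
  move=> /andP[s1 s2] /andP[t1 t2].
  have sw : `|s - p| <= w by rewrite ler_norml; lra.
  have th : `|t - q| <= h by rewrite ler_norml; lra.
  rewrite prod_normE /= !gt_max ge_max.
  by split; apply/andP; split; lra.
(* Both points are compared with (p, q), at the cost of e / 2 each. *)
have approx (f : R * R -> R) d : (forall k, `|k| < d ->
      `|f ((p, q) + k) - f (p, q) - 'd f (p, q) k| <= e / 2 * `|k|) ->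
    (forall s t, x <= s <= x + w -> y <= t <= y + h -> `|(s - p, t - q)| < d) ->
    forall s t s' t', x <= s <= x + w -> y <= t <= y + h ->
    x <= s' <= x + w -> y <= t' <= y + h ->
    `|f (s, t) - f (s', t') - 'd f (p, q) (s - s', t - t')| <= e * (w + h).
  move=> fd sd s t s' t' hs ht hs' ht'.
  have [_ _ n1] := nrm _ _ hs ht; have [_ _ n2] := nrm _ _ hs' ht'.
  have k1 := fd _ (sd _ _ hs ht); have k2 := fd _ (sd _ _ hs' ht').
  have -> : (s - s', t - t') = (s - p, t - q) - (s' - p, t' - q).
    by congr pair => /=; ring.
  rewrite linearB /=.
  rewrite (_ : (p, q) + (s - p, t - q) = (s, t)) in k1; last first.
    by congr pair => /=; ring.
  rewrite (_ : (p, q) + (s' - p, t' - q) = (s', t')) in k2; last first.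
    by congr pair => /=; ring.
  move: k1 k2; set D1 := 'd f (p, q) _; set D2 := 'd f (p, q) _.
  set n1' := `|(s - p, t - q)| in n1 *; set n2' := `|(s' - p, t' - q)| in n2 *.
  have e1 : e / 2 * n1' <= e / 2 * (w + h) by rewrite ler_wpM2l // ltW.
  have e2 : e / 2 * n2' <= e / 2 * (w + h) by rewrite ler_wpM2l // ltW.
  rewrite !ler_norml; lra.
(* [C] is the common value of dP/dy and dQ/dx at (p, q); the main terms [- h * C * w] and
   [w * C * h] cancel at the end. *)
set C := 'd P (p, q) (0, 1).
have lin1 s : 'd P (p, q) (0, s) = s * C.
  have -> : (0, s) = s *: (0, 1) :> R * R.
    by congr pair; rewrite /GRing.scale /= ?mulr0 ?mulr1.
  by rewrite linearZ.
have lin2 s : 'd Q (p, q) (s, 0) = s * C.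
  have -> : (s, 0) = s *: (1, 0) :> R * R.
    by congr pair; rewrite /GRing.scale /= ?mulr0 ?mulr1.
  by rewrite linearZ /C closedPQ.
have b1 : `|segint x (x + w) (fun t => P (t, y) - P (t, y + h)) - (- h * C) * (x + w - x)|
    <= e * (w + h) * (x + w - x).
  apply: segint_approx; first by rewrite lerDl.
    by move=> t; apply: continuousB; exact: cP1.
  move=> t tw; have := @approx P d1 d1P.
  move=> /(_ _ t y t (y + h)); rewrite subrr opprD addrA subrr add0r lin1.
  apply => //; last 2 first.
  - by rewrite lexx lerDl.
  - by rewrite lexx lerDl h0.
  by move=> s s' hs hs'; have [] := nrm _ _ hs hs'.
have b2 : `|segint y (y + h) (fun t => Q (x + w, t) - Q (x, t)) - (w * C) * (y + h - y)|
    <= e * (w + h) * (y + h - y).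
  apply: segint_approx; first by rewrite lerDl.
    by move=> t; apply: continuousB; exact: cQ2.
  move=> t tw; have := @approx Q d2 d2P.
  move=> /(_ _ (x + w) t x t); rewrite subrr [x + w - x]addrAC subrr add0r lin2.
  apply => //; last 2 first.
  - by rewrite lexx lerDl w0.
  - by rewrite lexx lerDl.
  by move=> s s' hs hs'; have [] := nrm _ _ hs hs'.
move: b1 b2; rewrite /loop; set i1 := segint _ _ _; set i2 := segint _ _ _.
rewrite !(addrAC _ _ (- _)) !subrr !add0r => b1 b2.
rewrite (_ : i1 + i2 = (i1 - - h * C * w) + (i2 - w * C * h)); last by ring.
apply: le_trans (ler_normD _ _) _; apply: le_trans (lerD b1 b2) _.
by rewrite le_eqVlt; apply/orP; left; apply/eqP; ring.
Qed.

Theorem goursat (x y w h : R) : 0 <= w -> 0 <= h ->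
  segint x (x + w) (fun t => P (t, y) - P (t, y + h)) +
  segint y (y + h) (fun t => Q (x + w, t) - Q (x, t)) = 0.
Proof.
move=> w0 h0; rewrite -[LHS]/(loop x y w h); apply/eqP; rewrite -normr_eq0.
apply/eqP/le_anti; rewrite normr_ge0 andbT.
have main e : 0 < e -> `|loop x y w h| <= e * (w + h) ^+ 2.
  move=> e0; move: x y w h w0 h0.
  apply: rectangle_bisection; last exact: loop_local.
  move=> x y w h w0 h0.
  have w20 : 0 <= w / 2 by rewrite divr_ge0.
  have h20 : 0 <= h / 2 by rewrite divr_ge0.
  have -> : loop x y w h = loop x y (w / 2) (h / 2) + loop (x + w / 2) y (w / 2) (h / 2)
    + (loop x (y + h / 2) (w / 2) (h / 2) +
       loop (x + w / 2) (y + h / 2) (w / 2) (h / 2)).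
    rewrite -(loop_split1 x y (h / 2) w20 w20).
    rewrite -(loop_split1 x (y + h / 2) (h / 2) w20 w20).
    by rewrite -(splitr w) -(loop_split2 x y w h20 h20) -(splitr h).
  have -> : e * (w + h) ^+ 2 = 4 * (e * (w / 2 + h / 2) ^+ 2) by field.
  set E := e * _; move=> t1 t2 t3 t4.
  apply: le_trans (ler_normD _ _) _.
  have := ler_normD (loop x y (w / 2) (h / 2)) (loop (x + w / 2) y (w / 2) (h / 2)).
  have := ler_normD (loop x (y + h / 2) (w / 2) (h / 2))
    (loop (x + w / 2) (y + h / 2) (w / 2) (h / 2)).
  move: t1 t2 t3 t4; lra.
apply/ler_addgt0Pr => e e0; rewrite add0r.
(* The [+ 1] allows for a degenerate rectangle. *)
have s0 : 0 < (w + h) ^+ 2 + 1 by rewrite ltr_pwDr // sqr_ge0.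
apply: le_trans (main (e / ((w + h) ^+ 2 + 1)) _) _; first by rewrite divr_gt0.
rewrite -mulrA ger_pMr // mulrC ler_pdivrMr // mul1r; lra.
Qed.

End Goursat.

(** * Calculus rules for differentials *)

Section DiffRules.
Context {R : realType}.
Implicit Types V W : normedModType R.

Lemma is_diffMfun V (f g df dg : V -> R) z : is_diff z f df -> is_diff z g dg ->
  is_diff z (fun x => f x * g x) (fun k => f z * dg k + g z * df k).
Proof. by move=> hf hg; exact: is_diffM. Qed.

Lemma is_diffDfun V W (f g df dg : V -> W) z : is_diff z f df -> is_diff z g dg ->
  is_diff z (fun x => f x + g x) (fun k => df k + dg k).
Proof. by move=> hf hg; exact: is_diffD. Qed.

Lemma is_diffBfun V W (f g df dg : V -> W) z : is_diff z f df -> is_diff z g dg ->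
  is_diff z (fun x => f x - g x) (fun k => df k - dg k).
Proof. by move=> hf hg; exact: is_diffB. Qed.

Lemma is_diff_compfun (U V W : normedModType R) (f df : U -> V) (g dg : V -> W) z :
  is_diff z f df -> is_diff (f z) g dg ->
  is_diff z (fun x => g (f x)) (fun k => dg (df k)).
Proof. by move=> hf hg; exact: is_diff_comp. Qed.

Lemma is_diff_scale_vec V W (f df : V -> R) (w : W) z :
  is_diff z f df -> is_diff z (fun x => f x *: w) (fun k => df k *: w).
Proof.
move=> [hf <-]; split; first exact: differentiableZl.
by rewrite diffZl.
Qed.

Lemma is_diff_derive_comp V (f df : V -> R) (g : R -> R) z g' :
  is_diff z f df -> is_derive (f z) (1 : R) g g' ->
  is_diff z (fun x => g (f x)) (fun k => df k * g').
Proof.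
move=> hf [dg gE].
have hg : is_diff (f z : R^o) g (fun h => h * g').
  split; first exact/derivable1_diffP.
  by rewrite deriv1E // derive1E gE.
exact: (is_diff_compfun hf hg).
Qed.

Lemma is_diff_fst (z : R * R) : is_diff z fst fst.
Proof.
have c : continuous (fst : R * R -> R) by move=> x; exact: cvg_fst.
by split; [exact: linear_differentiable|rewrite diff_lin].
Qed.

Lemma is_diff_snd (z : R * R) : is_diff z snd snd.
Proof.
have c : continuous (snd : R * R -> R) by move=> x; exact: cvg_snd.
by split; [exact: linear_differentiable|rewrite diff_lin].
Qed.

Lemma is_diff_val V W (f df : V -> W) z k : is_diff z f df -> 'd f z k = df k.
Proof. by case=> _ ->. Qed.

End DiffRules.

(** * Cauchy's formula for the first derivative *)

Section CauchyFormula.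
Context {R : realType} (V : normedModType R) (J : V -> V).
Implicit Types (u v : V -> R) (z w : V) (r t : R).

(** The function u + i v is holomorphic at [z] for the structure [J]: the two equations say that its
    differential sends [J w] to i times its value at [w]. *)
Definition holo_at u v z := [/\ differentiable u z, differentiable v z &
  forall w, 'd u z (J w) = - 'd v z w /\ 'd v z (J w) = 'd u z w].

Definition entire u v := forall z, holo_at u v z.

(** This is - i (u + i v). It turns every result on [u] into one on [v]. *)
Lemma entire_rot u v : entire u v -> entire v (fun z => - u z).
Proof.
move=> H z; have [du dv CR] := H z.
have dN w : 'd (fun z => - u z) z w = - 'd u z w by rewrite (diffN du).
split; [exact: dv|exact: differentiableN|move=> w].
have [CR1 CR2] := CR w; split.
  by rewrite (dN w) opprK; exact: CR2.
by rewrite (dN (J w)) CR1; exact: opprK.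
Qed.

(** The point z + r e^(i t) w. *)
Definition circle z w r t := z + r *: (cos t *: w + sin t *: J w).

(** Real part of the integral of f(z + r e^(i t) w) e^(- i t) over a period, for f = u + i v; it is
    not divided by 2 pi. *)
Definition circle_mean u v z w r : R := segint 0 (pi *+ 2) (fun t =>
  u (circle z w r t) * cos t + v (circle z w r t) * sin t).

(** The radius is written as an exponential so that (ln r, t) are conformal coordinates, in which an
    annulus is a rectangle. *)
Lemma is_diff_circle z w (p : R * R) :
  is_diff p (fun q : R * R => circle z w (expR q.1) q.2) (fun k =>
    (expR p.1 * (k.1 * cos p.2 - k.2 * sin p.2)) *: w +
    (expR p.1 * (k.1 * sin p.2 + k.2 * cos p.2)) *: J w).
Proof.
have de := is_diff_derive_comp (is_diff_fst p) (is_derive_expR p.1).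
have dc := is_diff_derive_comp (is_diff_snd p) (is_derive_cos p.2).
have ds := is_diff_derive_comp (is_diff_snd p) (is_derive_sin p.2).
have d1 := is_diff_scale_vec w (is_diffMfun de dc).
have d2 := is_diff_scale_vec (J w) (is_diffMfun de ds).
have := is_diffDfun (is_diff_cst z p) (is_diffDfun d1 d2).
rewrite /circle => h.
have -> : (fun q : R * R => z + expR q.1 *: (cos q.2 *: w + sin q.2 *: J w)) =
  (fun q => cst z q + (expR q.1 * cos q.2 *: w + expR q.1 * sin q.2 *: J w)).
  by apply/funext => q; rewrite /= scalerDr !scalerA.
apply: is_diff_eq; apply/funext => k /=; rewrite add0r.
by congr (_ *: _ + _ *: _); ring.
Qed.

(** In the coordinates s = ln r and t, put g = e^(-(s + i t)) f. Then P = Im g and Q = Re g, so P ds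
    + Q dt = Im (g d(s + i t)) is closed. Goursat's theorem applies on [ln r1, ln r2] x [0, 2 pi];
    the sides t = 0 and t = 2 pi cancel by periodicity, and the other two are the scaled means. *)
Lemma cauchy_indep u v z w r1 r2 : entire u v -> 0 < r1 -> r1 <= r2 ->
  r2^-1 * circle_mean u v z w r2 = r1^-1 * circle_mean u v z w r1.
Proof.
move=> H r10 r12; have r20 : 0 < r2 by apply: lt_le_trans r12.
pose c (q : R * R) := circle z w (expR q.1) q.2.
pose P q := expR (- q.1) * (v (c q) * cos q.2 - u (c q) * sin q.2).
pose Q q := expR (- q.1) * (u (c q) * cos q.2 + v (c q) * sin q.2).
have dtrig (p : R * R) :
  [/\ is_diff p (fun q : R * R => expR (- q.1)) (fun k => - k.1 * expR (- p.1)),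
    is_diff p (fun q : R * R => cos q.2) (fun k => k.2 * - sin p.2) &
    is_diff p (fun q : R * R => sin q.2) (fun k => k.2 * cos p.2)].
  split.
  - apply: (@is_diff_derive_comp _ _ (fun q : R * R => - q.1) (fun k => - k.1) expR).
    exact: (is_diffN (is_diff_fst p)).
  - exact: is_diff_derive_comp (is_diff_snd p) (is_derive_cos p.2).
  - exact: is_diff_derive_comp (is_diff_snd p) (is_derive_sin p.2).
have duv (f : V -> R) p : differentiable f (c p) -> is_diff p (fun q => f (c q)) (fun k =>
    (expR p.1 * (k.1 * cos p.2 - k.2 * sin p.2)) * 'd f (c p) w +
    (expR p.1 * (k.1 * sin p.2 + k.2 * cos p.2)) * 'd f (c p) (J w)).
  move=> df; have h := is_diff_compfun (is_diff_circle z w p) (differentiableP df).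
  apply: is_diff_eq; apply/funext => k /=.
  by rewrite linearD /= !linearZ.
have dPQ p : [/\ differentiable P p, differentiable Q p & 'd P p (0, 1) = 'd Q p (1, 0)].
  have [de dc ds] := dtrig p; have [du dv CR] := H (c p).
  have := is_diffMfun de (is_diffBfun (is_diffMfun (duv v p dv) dc)
    (is_diffMfun (duv u p du) ds)).
  rewrite -/P => -[dP dPE].
  have := is_diffMfun de (is_diffDfun (is_diffMfun (duv u p du) dc)
    (is_diffMfun (duv v p dv) ds)).
  rewrite -/Q => -[dQ dQE].
  split; [exact: dP|exact: dQ|rewrite dPE dQE /=].
  have [CR1 CR2] := CR w; rewrite CR1 CR2.
  move: ('d u (c p) w) ('d v (c p) w) (u (c p)) (v (c p)) (cos p.2) (sin p.2).
  move: (expR p.1) (expR (- p.1)) => e e' a b c1 d1 x y; ring.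
have w0 : 0 <= ln r2 - ln r1 by rewrite subr_ge0 ler_ln.
have h0 : 0 <= pi *+ 2 :> R by rewrite mulrn_wge0 // pi_ge0.
have := @goursat _ P Q (fun p => let: And3 h _ _ := dPQ p in h)
  (fun p => let: And3 _ h _ := dPQ p in h) (fun p => let: And3 _ _ h := dPQ p in h)
  (ln r1) 0 (ln r2 - ln r1) (pi *+ 2) w0 h0.
have Pper t : P (t, 0) = P (t, 0 + pi *+ 2).
  by rewrite /P /c /circle /= add0r cos2pi sin2pi cos0 sin0.
rewrite (@eq_segint _ _ _ _ (fun=> 0)); last by move=> t; rewrite -Pper subrr.
rewrite segint_cst; last by rewrite lerDl subr_ge0 ler_ln.
rewrite mul0r !add0r addrCA subrr addr0.
have QE r : 0 < r ->
    segint 0 (pi *+ 2) (fun t => Q (ln r, t)) = r^-1 * circle_mean u v z w r /\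
    continuous (fun t => Q (ln r, t)).
  move=> r0.
  have cQ : continuous (fun t => Q (ln r, t)).
    move=> t; apply: differentiable_continuous.
    apply: (@differentiable_comp _ _ _ _ (fun t : R => (ln r, t)) Q) => //.
    by have [] := dPQ (ln r, t).
  split => //; rewrite -segintZ.
    by apply: eq_segint => t; rewrite /Q /c /= expRN lnK.
  have -> : (fun x => u (circle z w r x) * cos x + v (circle z w r x) * sin x) =
     (fun x => r * Q (ln r, x)).
    by apply/funext => x; rewrite /Q /c /= expRN lnK // mulVKf // gt_eqF.
  by move=> t; apply: cvgM; [exact: cvg_cst|exact: cQ].
have [e1 c1] := QE _ r10; have [e2 c2] := QE _ r20.
by rewrite segintB // e1 e2 => /eqP; rewrite subr_eq0 => /eqP.
Qed.
Lemma circle_mean_continuous u v z w r : entire u v ->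
  continuous (fun t => u (circle z w r t) * cos t + v (circle z w r t) * sin t).
Proof.
move=> H t.
have cc : {for t, continuous (circle z w r)}.
  apply: cvgD; first exact: cvg_cst.
  apply: cvgZr; apply: cvgD; apply: cvgZl.
    exact: continuous_cos.
  exact: continuous_sin.
have cf (f : V -> R) : (forall z, differentiable f z) ->
    {for t, continuous (fun t => f (circle z w r t))}.
  move=> df; apply: (@continuous_comp _ _ _ (circle z w r) f) => //.
  exact/differentiable_continuous.
apply: cvgD; apply: cvgM.
- by apply: cf => z'; have [] := H z'.
- exact: continuous_cos.
- by apply: cf => z'; have [] := H z'.
- exact: continuous_sin.
Qed.

Lemma segint_cos : segint 0 (pi *+ 2) cos = 0 :> R.
Proof.
rewrite (@segint_FTC _ _ _ sin) ?sin2pi ?sin0 ?subr0 //.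
- by rewrite mulrn_wgt0 // pi_gt0.
- exact: continuous_cos.
Qed.

Lemma segint_sin : segint 0 (pi *+ 2) sin = 0 :> R.
Proof.
have d (x : R) : is_derive x (1 : R) (fun x => - cos x) (sin x).
  by have := is_deriveN (is_derive_cos x); rewrite opprK; exact.
have c : continuous (@sin R) by exact: continuous_sin.
have p : 0 < pi *+ 2 :> R by rewrite mulrn_wgt0 // pi_gt0.
by rewrite (segint_FTC p c d) cos2pi cos0 subrr.
Qed.

Lemma norm_cos_sin_le (a b : R) t : `|a * cos t + b * sin t| <= `|a| + `|b|.
Proof.
apply: le_trans (ler_normD _ _) _; rewrite !normrM lerD //.
  by rewrite ler_piMr // cos_max.
by rewrite ler_piMr // sin_max.
Qed.

Hypothesis normJ : forall w, `|J w| <= `|w|.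

Lemma circle_dist z w r t : 0 < r ->
  `|r *: (cos t *: w + sin t *: J w)| <= r * (2 * `|w|).
Proof.
move=> r0; rewrite normrZ gtr0_norm // ler_pM2l //.
apply: le_trans (ler_normD _ _) _; rewrite !normrZ mulrDl !mul1r.
apply: lerD; first by rewrite ler_piMl // cos_max.
by apply: le_trans (normJ w); rewrite ler_piMl // sin_max.
Qed.

Lemma scaled_lt (s W m : R) : 0 < s -> 0 <= W -> 0 < m ->
  s <= m / (W + 1) / 2 -> s * W < m.
Proof.
move=> s0 W0 m0; rewrite -mulrA -invfM ler_pdivlMr; last by lra.
have : 0 <= s * W by rewrite mulr_ge0 // ltW.
by rewrite mulrDl mulrDr; lra.
Qed.

(** The quotient of the mean by the radius does not depend on the radius, so a small radius [s]
    suffices. There the constant terms have mean zero against cos and sin, and by the Cauchy-Riemann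
    equations the linear terms give ['d u z w] times cos^2 + sin^2. *)
Theorem cauchy_formula u v z w r : entire u v -> 0 < r ->
  circle_mean u v z w r = (pi *+ 2) * r * 'd u z w.
Proof.
move=> H r0; have pi20 : 0 < pi *+ 2 :> R by rewrite mulrn_wgt0 // pi_gt0.
suff main : r^-1 * circle_mean u v z w r = 'd u z w * (pi *+ 2).
  have -> : circle_mean u v z w r = r * (r^-1 * circle_mean u v z w r).
    by rewrite mulVKf // gt_eqF.
  by rewrite main; move: ('d u z w) => D; ring.
apply/eqP; rewrite -subr_eq0 -normr_eq0; apply/eqP/le_anti.
rewrite normr_ge0 andbT; apply/ler_addgt0Pr => e e0; rewrite add0r.
have w0 : 0 < 2 * `|w| + 1 by rewrite ltr_pwDr // mulr_ge0.
(* The final error is 2 e' (2 |w|) 2 pi; the [+ 1] covers w = 0. *)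
pose e' := e / ((pi *+ 2) * 2 * (2 * `|w| + 1)).
have e'0 : 0 < e' by rewrite divr_gt0 // !mulr_gt0.
have [du dv CR] := H z; have [CR1 CR2] := CR w.
have [d1 d10 d1P] := differentiable_approx du e'0.
have [d2 d20 d2P] := differentiable_approx dv e'0.
pose s := Num.min r (Num.min d1 d2 / (2 * `|w| + 1) / 2).
have s0 : 0 < s by rewrite !(lt_min, divr_gt0, r0, d10).
have sr : s <= r by rewrite ge_min lexx.
have sd : s * (2 * `|w|) < Num.min d1 d2.
  apply: scaled_lt; [exact: s0|by rewrite mulr_ge0| |by rewrite ge_min lexx orbT].
  by rewrite lt_min d10.
rewrite (cauchy_indep z w H s0 sr).
(* Subtracting the values at the centre does not change the integral, since cos and sin integrate to
   0. *)
pose g t := s^-1 * (u (circle z w s t) * cos t + v (circle z w s t) * sin t) -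
  (s^-1 * u z * cos t + s^-1 * v z * sin t).
have cm := @circle_mean_continuous u v z w s H.
have cZ (a : R) (h : R -> R) : continuous h -> continuous (fun t => a * h t).
  by move=> ch t; apply: cvgM; [exact: cvg_cst|exact: ch].
have cD (h k : R -> R) : continuous h -> continuous k -> continuous (fun t => h t + k t).
  by move=> ch ck t; apply: cvgD; [exact: ch|exact: ck].
have cgt : continuous (fun t : R => s^-1 * u z * cos t + s^-1 * v z * sin t).
  by apply: cD; apply: cZ; [exact: continuous_cos|exact: continuous_sin].
have cg : continuous g.
  by move=> t; apply: cvgB; [exact: (cZ _ _ cm)|exact: cgt].
have -> : s^-1 * circle_mean u v z w s = segint 0 (pi *+ 2) g.
  rewrite segintB //; last exact: cZ.
  rewrite segintZ // [X in _ - X](_ : _ = 0) ?subr0 //.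
  have -> : (fun x => s^-1 * u z * cos x + s^-1 * v z * sin x) =
    (fun x => s^-1 * u z * cos x - (- (s^-1 * v z)) * sin x).
    by apply/funext => x; rewrite mulNr opprK.
  rewrite segintB; [|by apply: cZ; exact: continuous_cos|by apply: cZ; exact: continuous_sin].
  by rewrite !segintZ ?segint_cos ?segint_sin ?mulr0 ?subr0 //;
    [exact: continuous_sin|exact: continuous_cos].
have -> : 'd u z w * (pi *+ 2) = 'd u z w * (pi *+ 2 - 0) by rewrite subr0.
apply: le_trans (segint_approx (M := 2 * e' * (2 * `|w|)) _ cg _) _; first exact: ltW.
  move=> t _; set k := s *: (cos t *: w + sin t *: J w).
  have kw := circle_dist z w t s0.
  have /d1P b1 : `|k| < d1 by apply: le_lt_trans kw (lt_le_trans sd _); rewrite ge_min lexx.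
  have /d2P b2 : `|k| < d2 by apply: le_lt_trans kw (lt_le_trans sd _); rewrite ge_min lexx orbT.
  have lk (f : V -> R) : 'd f z k = s * (cos t * 'd f z w + sin t * 'd f z (J w)).
    by rewrite /k linearZ linearD !linearZ.
  rewrite lk CR1 in b1; rewrite lk CR2 in b2.
  rewrite /g /circle -/k.
  have cs := cos2Dsin2 t.
  have -> : s^-1 * (u (z + k) * cos t + v (z + k) * sin t) -
      (s^-1 * u z * cos t + s^-1 * v z * sin t) - 'd u z w
    = s^-1 * ((u (z + k) - u z - s * (cos t * 'd u z w + sin t * - 'd v z w)) * cos t
           + (v (z + k) - v z - s * (cos t * 'd v z w + sin t * 'd u z w)) * sin t).
    rewrite -[X in _ - X = _]mul1r -cs.
    move: ('d u z w) ('d v z w) (u z) (v z) (u _) (v _) (cos t) (sin t) s0.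
    move: (s) => s' A B C D E F G I s'0; field; exact: lt0r_neq0.
  rewrite normrM gtr0_norm ?invr_gt0 // mulrC ler_pdivrMr //.
  apply: le_trans (norm_cos_sin_le _ _ _) _.
  apply: le_trans (lerD b1 b2) _.
  have := ler_wpM2l (ltW e'0) kw; rewrite -/k.
  by move: (`|k|) (`|w|) (e') (s) => K W e1 s1; lra.
rewrite subr0 /e'.
have -> : 2 * (e / (pi *+ 2 * 2 * (2 * `|w| + 1))) * (2 * `|w|) * (pi *+ 2) =
    e * ((2 * `|w|) / (2 * `|w| + 1)).
  move: (`|w|) w0 (pi *+ 2) pi20 => W W0 p p0; field.
  by rewrite !lt0r_neq0.
by rewrite ger_pMr // ler_pdivrMr // mul1r lerDl.
Qed.

End CauchyFormula.

(** * Regularity and Liouville's theorem *)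

Section MeanValue.
Context {R : realType} (V : normedModType R).

Lemma line_is_derive (f : V -> R) (z h : V) (s : R) : differentiable f (z + s *: h) ->
  is_derive s (1 : R) (fun s => f (z + s *: h)) ('d f (z + s *: h) h).
Proof.
move=> df.
have dl : is_diff (s : R^o) (fun s : R => z + s *: h) (fun k : R => k *: h).
  have h1 := is_diff_scale_vec h (is_diff_id (s : R^o)).
  apply: (is_diff_eq (is_diffDfun (is_diff_cst z (s : R^o)) h1)).
  by apply/funext => k /=; rewrite add0r.
have := is_diff_compfun dl (differentiableP df) => -[d1 d2].
split; first exact/derivable1_diffP.
by rewrite deriveE // d2 scale1r.
Qed.

Lemma mvt_line (f : V -> R) (z h : V) : (forall x, differentiable f x) ->
  exists2 c : R, 0 <= c <= 1 & f (z + h) - f z = 'd f (z + c *: h) h.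
Proof.
move=> df.
have dF (s : R) := line_is_derive (df (z + s *: h)).
have cF : {within `[0, 1], continuous (fun s : R => f (z + s *: h))}.
  apply: continuous_subspaceT => s; apply: differentiable_continuous.
  by apply/derivable1_diffP; have [] := dF s.
have [c] := MVT_segment ler01 (fun x _ => dF x) cF.
rewrite in_itv /= => c01; rewrite scale1r scale0r addr0 subr0 mulr1 => ->.
by exists c.
Qed.

(** The bound [C] gives the continuity of [L], which a differential must have and which linearity
    alone does not provide. *)
Lemma is_diff_littleo (W : normedModType R) (f L : V -> W) (z : V) (C : R) :
  linear L -> (forall h, `|L h| <= C * `|h|) ->
  (forall e, 0 < e -> exists2 d, 0 < d & forall h, `|h| < d ->
    `|f (z + h) - f z - L h| <= e * `|h|) ->
  is_diff z f L.
Proof.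
move=> linL LC fo.
pose lM := GRing.isLinear.Build _ _ _ _ _ linL.
pose lL : {linear V -> W} := HB.pack L lM.
have Lcont : continuous L.
  apply: (@bounded_linear_continuous _ _ _ lL).
  apply/linear_boundedP; near=> M => x.
  by apply: le_trans (LC x) _; rewrite ler_wpM2r.
have app : f \o shift z = cst (f z) + lL +o_ 0 id.
  apply/eqaddoP => e e0; apply/nbhs_normP.
  have [d d0 fd] := fo e e0; exists d => // k /=; rewrite sub0r normrN => kd.
  by have := fd k kd; rewrite -[_ - _ - _]addrA -opprD [z + k]addrC.
have dE : 'd f z = lL :> (V -> W) by exact: diff_unique.
split; last exact: dE.
by apply/diff_locallyP; rewrite dE; split.
Unshelve. all: by end_near. Qed.

Lemma is_diff_quadratic (f L : V -> R) (z : V) (C d : R) : linear L ->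
  0 < d -> (forall h, `|L h| <= C * `|h|) ->
  (forall h, `|h| < d -> `|f (z + h) - f z - L h| <= C * `|h| ^+ 2) ->
  is_diff z f L.
Proof.
move=> linL d0 LC fC; apply: (is_diff_littleo linL LC) => e e0.
have C1 : 0 < `|C| + 1 by rewrite ltr_pwDr.
exists (Num.min d (e / (`|C| + 1))); first by rewrite lt_min d0 divr_gt0.
move=> k; rewrite lt_min => /andP[kd ke].
apply: le_trans (fC k kd) _; rewrite expr2 mulrA ler_wpM2r //.
apply: le_trans (_ : (`|C| + 1) * `|k| <= _).
  by rewrite ler_wpM2r // (le_trans (ler_norm C)) // lerDl.
by rewrite mulrC -ler_pdivlMr // ltW.
Qed.

End MeanValue.

(** * Cauchy's estimates and second-order expansions *)

Section Estimates.
Context {R : realType} (V : normedModType R) (J : V -> V).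
Hypothesis normJ : forall w, `|J w| <= `|w|.
Implicit Types (u v : V -> R) (z w h : V) (r t : R).

Local Notation entire := (entire J).
Local Notation circle := (circle J).

(** The factor 2 comes from |u cos t + v sin t| <= |u| + |v|. *)
Lemma cauchy_estimate u v z w r (M : R) : entire u v -> 0 < r ->
  (forall t, `|u (circle z w r t)| <= M /\ `|v (circle z w r t)| <= M) ->
  `|'d u z w| <= 2 * M / r.
Proof.
move=> H r0 HM.
have p0 : 0 < pi *+ 2 :> R by rewrite mulrn_wgt0 // pi_gt0.
have := @segint_norm_le R 0 (pi *+ 2) (2 * M) _ (ltW p0)
  (@circle_mean_continuous _ _ _ _ _ z w r H).
rewrite -/(circle_mean J u v z w r) (cauchy_formula normJ z w H r0) subr0 => E.
have {}E : `|pi *+ 2 * r * 'd u z w| <= 2 * M * (pi *+ 2).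
  apply: E => t _; apply: le_trans (norm_cos_sin_le _ _ _) _.
  by have [h1 h2] := HM t; rewrite mulrDl mul1r lerD.
rewrite ler_pdivlMr //; move: E; rewrite normrM gtr0_norm ?mulr_gt0 //.
move: (`|'d u z w|) => D; rewrite -[_ * r * D]mulrA [_ * (r * D)]mulrC.
by rewrite ler_pM2r // [r * D]mulrC.
Qed.

Lemma circle_near z w r t : 0 < r -> `|circle z w r t - z| <= r * (2 * `|w|).
Proof. by move=> r0; rewrite /circle addrAC subrr add0r circle_dist. Qed.

(** Continuity bounds [u] and [v] near [z]; Cauchy's estimate on a circle of radius proportional to
    1 / |w| turns this into a bound linear in [w]. *)
Lemma entire_differential_bound u v z : entire u v -> exists d M : R,
  [/\ 0 < d, 0 <= M & forall x, `|x - z| < d -> forall w,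
    `|'d u x w| <= M * `|w| /\ `|'d v x w| <= M * `|w|].
Proof.
move=> H; have [du dv _] := H z.
have bnd (f : V -> R) : differentiable f z -> exists2 d : R, 0 < d &
    forall x, `|x - z| < d -> `|f x| <= `|f z| + 1.
  move=> /differentiable_continuous /cvgrPdist_le /(_ 1 ltr01).
  move=> /nbhs_normP [d /= d0 dP]; exists d => // x xd.
  have := dP x; rewrite /= distrC => /(_ xd) => h.
  rewrite -[f x](subrK (f z)) addrC; apply: le_trans (ler_normD _ _) _.
  by rewrite lerD2l distrC.
have [d1 d10 b1] := bnd u du; have [d2 d20 b2] := bnd v dv.
pose M := `|u z| + `|v z| + 1; pose d := Num.min d1 d2.
have d0 : 0 < d by rewrite lt_min d10.
have M0 : 0 < M by rewrite ltr_pwDr // addr_ge0.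
exists (d / 2), (16 * M / d); split; [by rewrite divr_gt0| |].
  by rewrite divr_ge0 ?mulr_ge0 // ltW.
move=> x xz w; have [-> | w0] := eqVneq w 0; first by rewrite !linear0 !normr0 mulr0.
have nw : 0 < `|w| by rewrite normr_gt0.
(* The circle then stays within 2 r |w| = d / 4 of [x], hence in the ball of radius [d] around
   [z]. *)
pose r := d / (8 * `|w|); have r0 : 0 < r by rewrite divr_gt0 // mulr_gt0.
have cz t : `|circle x w r t - z| < d.
  have -> : circle x w r t - z = (circle x w r t - x) + (x - z) by rewrite addrA subrK.
  apply: le_lt_trans (ler_normD _ _) _; have := circle_near x w t r0.
  have -> : r * (2 * `|w|) = d / 4.
    by rewrite /r; move: (`|w|) (d) nw => a b a0; field; rewrite lt0r_neq0.
  move: d0 xz; move: (`|_ - x|) (`|x - z|) (d) => a b c; lra.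
have uM t : `|u (circle x w r t)| <= M.
  apply: le_trans (b1 _ _) _; first by apply: lt_le_trans (cz t) _; rewrite ge_min lexx.
  by rewrite lerD2r lerDl.
have vM t : `|v (circle x w r t)| <= M.
  apply: le_trans (b2 _ _) _; first by apply: lt_le_trans (cz t) _; rewrite ge_min lexx orbT.
  by rewrite lerD2r lerDr.
have rE : 16 * M / d * `|w| = 2 * M / r.
  rewrite /r; move: (`|w|) (d) nw d0 => a b a0 b0; field; by rewrite !lt0r_neq0.
rewrite rE; split; first by apply: cauchy_estimate H r0 _.
by apply: (cauchy_estimate (entire_rot H) r0) => t; rewrite normrN.
Qed.

(** Since an increment of an entire function is entire, Cauchy's estimate will bound the increments
    of the differential. *)
Lemma entire_shift u v h : entire u v ->
  entire (fun x => u (x + h) - u x) (fun x => v (x + h) - v x) /\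
  forall x w, 'd (fun x => u (x + h) - u x) x w = 'd u (x + h) w - 'd u x w.
Proof.
move=> H.
have sh (f : V -> R) x : differentiable f x -> differentiable f (x + h) ->
    is_diff x (fun x => f (x + h) - f x) (fun k => 'd f (x + h) k - 'd f x k).
  move=> df1 df2.
  have h1 : is_diff x (fun x => x + h) (fun k => k).
    apply: (is_diff_eq (is_diffDfun (is_diff_id x) (is_diff_cst h x))).
    by apply/funext => k /=; rewrite addr0.
  have h2 := is_diff_compfun h1 (differentiableP df2).
  exact: is_diffBfun h2 (differentiableP df1).
have sw (f g : V -> R) : entire f g -> forall x w,
    'd (fun x => f (x + h) - f x) x w = 'd f (x + h) w - 'd f x w.
  move=> E x w; have [df1 _ _] := E x; have [df2 _ _] := E (x + h).
  exact: is_diff_val (sh f x df1 df2).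
split; last exact: sw H.
move=> x; have [du1 dv1 CR1] := H x; have [du2 dv2 CR2] := H (x + h).
split; [by have [] := sh u x du1 du2|by have [] := sh v x dv1 dv2|move=> w].
have vw y : 'd (fun x => v (x + h) - v x) x y = 'd v (x + h) y - 'd v x y.
  exact: is_diff_val (sh v x dv1 dv2).
have [a1 a2] := CR1 w; have [b1 b2] := CR2 w; split.
  by rewrite (sw u v H x (J w)) (vw w) a1 b1 -opprD.
by rewrite (sw u v H x w) (vw (J w)) a2 b2.
Qed.

(** By the mean value theorem the increments of [u] and [v] are at most M |h|; Cauchy's estimate
    applied to these increments, as functions of the base point, transfers the bound to the
    differential. *)
Lemma entire_differential_lipschitz u v z : entire u v -> exists d C : R,
  [/\ 0 < d, 0 <= C & forall x h, `|x - z| < d -> `|h| < d -> forall w,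
    `|'d u (x + h) w - 'd u x w| <= C * `|h| * `|w| ].
Proof.
move=> H; have [d [M [d0 M0 HM]]] := entire_differential_bound z H.
have lip x h : `|x - z| + `|h| < d ->
    `|u (x + h) - u x| <= M * `|h| /\ `|v (x + h) - v x| <= M * `|h|.
  move=> xh.
  have st (c : R) : 0 <= c <= 1 -> `|x + c *: h - z| < d.
    move=> /andP[c0 c1]; apply: le_lt_trans xh.
    rewrite addrAC; apply: le_trans (ler_normD _ _) _; rewrite lerD2l normrZ.
    by rewrite ler_piMl // ger0_norm.
  have [c1 c1P ->] := @mvt_line _ _ u x h (fun y => let: And3 a _ _ := H y in a).
  have [c2 c2P ->] := @mvt_line _ _ v x h (fun y => let: And3 _ a _ := H y in a).
  by split; [case: (HM _ (st _ c1P) h)|case: (HM _ (st _ c2P) h)].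
exists (d / 4), (16 * M / d); split; [by rewrite divr_gt0| |].
  by rewrite divr_ge0 ?mulr_ge0 // ltW.
move=> x h xz hd w; have [-> | w0] := eqVneq w 0.
  by rewrite (linear0 ('d u (x + h))) (linear0 ('d u x)) subrr !normr0 mulr0.
have nw : 0 < `|w| by rewrite normr_gt0.
pose r := d / (8 * `|w|); have r0 : 0 < r by rewrite divr_gt0 // mulr_gt0.
have [E sE] := entire_shift h H; rewrite -sE.
have -> : 16 * M / d * `|h| * `|w| = 2 * (M * `|h|) / r.
  rewrite /r; move: (`|w|) (d) (`|h|) nw d0 => a b c a0 b0; field; by rewrite !lt0r_neq0.
apply: (cauchy_estimate E r0) => t; apply: lip.
have -> : circle x w r t - z = (circle x w r t - x) + (x - z) by rewrite addrA subrK.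
have := ler_normD (circle x w r t - x) (x - z); have := circle_near x w t r0.
have -> : r * (2 * `|w|) = d / 4.
    by rewrite /r; move: (`|w|) (d) nw => a b a0; field; rewrite lt0r_neq0.
move: xz hd d0; move: (`|_ - x|) (`|x - z|) (`|_ + _|) (`|h|) (d) => a b c e f; lra.
Qed.

Lemma entire_differential_continuous u v w : entire u v ->
  continuous (fun x => 'd u x w).
Proof.
move=> H z; have [d [C [d0 C0 L]]] := entire_differential_lipschitz z H.
apply/cvgrPdist_le => e e0; apply/nbhs_normP.
have P0 : 0 < C * `|w| + 1 by rewrite ltr_pwDr // mulr_ge0.
exists (Num.min d (e / (C * `|w| + 1))); first by rewrite /= lt_min d0 divr_gt0.
move=> x /=; rewrite lt_min distrC => /andP[xd xe].
have := L z (x - z); rewrite subrr normr0 => /(_ d0 xd w).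
rewrite [z + _]addrC subrK distrC => h; apply: le_trans h _.
move: xe; rewrite ltr_pdivlMr // => xe; apply/ltW/(le_lt_trans _ xe).
by rewrite mulrAC mulrC ler_wpM2l // lerDl.
Qed.

(** The constant is uniform in the base point [x], so that the expansion can be used at every point
    of a small circle under the integral sign. *)
Lemma entire_second_order u v z : entire u v -> exists d C : R,
  [/\ 0 < d, 0 <= C & forall x h, `|x - z| < d -> `|h| < d ->
    `|u (x + h) - u x - 'd u x h| <= C * `|h| ^+ 2 ].
Proof.
move=> H; have [d [C [d0 C0 L]]] := entire_differential_lipschitz z H.
exists d, C; split => // x h xd hd.
have [c /andP[c0 c1] ->] := @mvt_line _ _ u x h (fun y => let: And3 a _ _ := H y in a).
have ch : `|c *: h| <= `|h| by rewrite normrZ ger0_norm // ler_piMl.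
apply: le_trans (L x (c *: h) xd (le_lt_trans ch hd) h) _.
by rewrite expr2 mulrA ler_wpM2r // ler_wpM2l.
Qed.

End Estimates.

(** * Differentiability of differentials and Liouville's theorem *)

Section Liouville.
Context {R : realType} (V : normedModType R) (J : V -> V).
Hypothesis normJ : forall w, `|J w| <= `|w|.
Implicit Types (u v : V -> R) (z w h : V) (r t : R).

Local Notation entire := (entire J).
Local Notation circle := (circle J).

(** Cauchy's formula for ['d u z w], differentiated in [z] along [h] under the integral sign. *)
Definition differential_mean u v z w r h : R := (pi *+ 2 * r)^-1 *
  segint 0 (pi *+ 2) (fun t => 'd u (circle z w r t) h * cos t +
                               'd v (circle z w r t) h * sin t).

Lemma differential_mean_continuous u v z w r h : entire u v ->
  continuous (fun t => 'd u (circle z w r t) h * cos t +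
                       'd v (circle z w r t) h * sin t).
Proof.
move=> H t.
have cc : {for t, continuous (circle z w r)}.
  apply: cvgD; first exact: cvg_cst.
  apply: cvgZr; apply: cvgD; apply: cvgZl.
    exact: continuous_cos.
  exact: continuous_sin.
have cu := @continuous_comp _ _ _ (circle z w r) (fun x => 'd u x h) t cc
  (entire_differential_continuous normJ (w := h) H (x := _)).
have cv := @continuous_comp _ _ _ (circle z w r) (fun x => 'd v x h) t cc
  (entire_differential_continuous normJ (w := h) (entire_rot H) (x := _)).
apply: cvgD; apply: cvgM; [exact: cu|exact: continuous_cos|exact: cv|exact: continuous_sin].
Qed.

(** The increment of the circle mean is an integral of increments; the uniform second-order
    expansion bounds its distance to [differential_mean] by a multiple of |h|^2. *)
Lemma differential_is_diff u v z w : entire u v -> exists2 r0 : R, 0 < r0 &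
  forall r, 0 < r < r0 ->
    is_diff z (fun x => 'd u x w) (differential_mean u v z w r).
Proof.
move=> H; have p0 : 0 < pi *+ 2 :> R by rewrite mulrn_wgt0 // pi_gt0.
have [d1 [C1 [d10 C10 H1]]] := entire_second_order normJ z H.
have [d2 [C2 [d20 C20 H2]]] := entire_second_order normJ z (entire_rot H).
have [d3 [M [d30 M0 H3]]] := entire_differential_bound normJ z H.
have w1 : 0 < 2 * `|w| + 1 by rewrite ltr_pwDr // mulr_ge0.
pose d := Num.min d1 (Num.min d2 d3).
have d0 : 0 < d by rewrite !lt_min d10 d20 d30.
exists (d / (2 * `|w| + 1)); first exact: divr_gt0.
move=> r /andP[r0]; rewrite ltr_pdivlMr // => rd.
have cd t : `|circle z w r t - z| < d.
  apply: le_lt_trans (circle_near normJ z w t r0) (le_lt_trans _ rd).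
  by rewrite ler_pM2l // lerDl.
have cm := fun h => @differential_mean_continuous u v z w r h H.
have pr0 : 0 < pi *+ 2 * r by rewrite mulr_gt0.
have scale (f : R -> R) (K : R) : continuous f -> (forall t, `|f t| <= K) ->
    `|(pi *+ 2 * r)^-1 * segint 0 (pi *+ 2) f| <= K / r.
  move=> cf fK; rewrite normrM gtr0_norm ?invr_gt0 // mulrC ler_pdivrMr //.
  apply: le_trans (segint_norm_le (ltW p0) cf (fun t _ => fK t)) _.
  rewrite subr0 le_eqVlt; apply/orP; left; apply/eqP.
  by move: (pi *+ 2) (K) (r) r0 => a b c c0; field; rewrite lt0r_neq0.
have dlin (f : V -> R) x a h k : 'd f x (a *: h + k) = a * 'd f x h + 'd f x k.
  exact: (linearP ('d f x)).
have lin : linear (differential_mean u v z w r).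
  move=> a h k; rewrite /differential_mean.
  rewrite (@eq_segint _ _ _ _ (fun t =>
     a * ('d u (circle z w r t) h * cos t + 'd v (circle z w r t) h * sin t) +
     ('d u (circle z w r t) k * cos t + 'd v (circle z w r t) k * sin t))); last first.
    move=> t; rewrite (dlin u) (dlin v).
    move: ('d u _ h) ('d v _ h) ('d u _ k) ('d v _ k) (cos t) (sin t) => x1 x2 x3 x4 x5 x6.
    ring.
  rewrite segintD; [|by move=> t; apply: cvgM; [exact: cvg_cst|exact: cm]|exact: cm].
  by rewrite segintZ; [rewrite mulrDr mulrCA|exact: cm].
(* A single constant serves two bounds: [2 * M / r] for the linear map and [(C1 + C2) / r] for the
   remainder. *)
apply: (@is_diff_quadratic _ _ _ _ _ ((2 * M + C1 + C2) / r) d) => //.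
  move=> h; apply: le_trans (scale _ (2 * M * `|h|) (cm h) _) _.
    move=> t; apply: le_trans (norm_cos_sin_le _ _ _) _.
    have /H3 /(_ h) [] : `|circle z w r t - z| < d3.
      by apply: lt_le_trans (cd t) _; rewrite !ge_min lexx !orbT.
    by rewrite -mulrA mulrDl mul1r => *; exact: lerD.
  rewrite mulrAC ler_wpM2r // ler_wpM2r //; first by rewrite invr_ge0 ltW.
  by rewrite -addrA lerDl addr_ge0.
move=> h hd.
have dE x : 'd u x w = (pi *+ 2 * r)^-1 * circle_mean J u v x w r.
  by rewrite (cauchy_formula normJ x w H r0) mulrA mulVf ?mul1r // lt0r_neq0.
rewrite (dE (z + h)) (dE z) /differential_mean -!mulrBr /circle_mean.
have c1 := @circle_mean_continuous _ _ _ _ _ (z + h) w r H.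
have c2 := @circle_mean_continuous _ _ _ _ _ z w r H.
have c12 : continuous (fun t =>
   u (circle (z + h) w r t) * cos t + v (circle (z + h) w r t) * sin t -
   (u (circle z w r t) * cos t + v (circle z w r t) * sin t)).
  by move=> t; apply: cvgB; [exact: c1|exact: c2].
rewrite -(segintB _ _ c1 c2) -(segintB _ _ c12 (cm h)).
apply: le_trans (scale _ ((C1 + C2) * `|h| ^+ 2) _ _) _.
- by move=> t; apply: cvgB; [exact: c12|exact: cm].
- move=> t; have -> : circle (z + h) w r t = circle z w r t + h.
    by rewrite /circle addrAC.
  have b1 := H1 (circle z w r t) h (lt_le_trans (cd t) _) (lt_le_trans hd _).
  have b2 := H2 (circle z w r t) h (lt_le_trans (cd t) _) (lt_le_trans hd _).
  have {b1} := b1 _ _; rewrite !ge_min lexx /= => /(_ isT isT) b1.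
  have {b2} := b2 _ _; rewrite !ge_min lexx /= orbT => /(_ isT isT) b2.
  have := le_trans (norm_cos_sin_le _ _ t) (lerD b1 b2); rewrite -mulrDl.
  congr (_ <= _); congr (`| _ |).
  move: ('d u _ h) ('d v _ h) (u _) (v _) (u (circle _ _ _ _)) (v (circle _ _ _ _)) (cos t) (sin t).
  move=> *; ring.
rewrite mulrAC ler_wpM2r ?sqr_ge0 // ler_wpM2r //; first by rewrite invr_ge0 ltW.
by rewrite -addrA lerDr mulr_ge0.
Qed.

(** The Cauchy-Riemann equations hold for the integrands of the two means, hence for the means. *)
Lemma entire_differential u v w : entire u v ->
  entire (fun x => 'd u x w) (fun x => 'd v x w).
Proof.
move=> H z.
have [r1 r10 D1] := differential_is_diff z w H.
have [r2 r20 D2] := differential_is_diff z w (entire_rot H).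
(* One radius for both means, so that their integrands are taken on the same circle. *)
pose r := Num.min r1 r2 / 2.
have m0 : 0 < Num.min r1 r2 by rewrite lt_min r10.
have m2 : r < Num.min r1 r2 by rewrite ltr_pdivrMr // mulr_natr mulr2n ltrDl.
have r0 : 0 < r by rewrite divr_gt0.
have [|du dE] := D1 r; first by rewrite r0 (lt_le_trans m2) // ge_min lexx.
have [|dv vE] := D2 r; first by rewrite r0 (lt_le_trans m2) // ge_min lexx orbT.
have dN x h : 'd (fun y => - u y) x h = - 'd u x h.
  by have [du' _ _] := H x; rewrite (diffN du').
split; [exact: du|exact: dv|move=> h].
have uE k : 'd (fun x => 'd u x w) z k = differential_mean u v z w r k by rewrite dE.
have vE' k : 'd (fun x => 'd v x w) z k = differential_mean v (fun y => - u y) z w r k.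
  by rewrite vE.
have CR t : [/\ 'd u (circle z w r t) (J h) = - 'd v (circle z w r t) h,
     'd v (circle z w r t) (J h) = 'd u (circle z w r t) h &
     forall k, 'd (fun y => - u y) (circle z w r t) k = - 'd u (circle z w r t) k].
  by have [_ _ /(_ h) [h1 h2]] := H (circle z w r t); split; [exact: h1|exact: h2|exact: dN].
split.
  apply: etrans (uE (J h)) (etrans _ (esym (congr1 -%R (vE' h)))).
  rewrite /differential_mean -mulrN; congr (_ * _).
  have cI := @differential_mean_continuous v (fun y => - u y) z w r h (entire_rot H).
  rewrite -mulN1r -(segintZ _ _ _ cI).
  apply: eq_segint => t; have [c1 c2 c3] := CR t; rewrite c1 c2 (c3 h).
  by move: ('d u _ _) ('d v _ _) (cos t) (sin t) => a b c d; ring.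
apply: etrans (vE' (J h)) (etrans _ (esym (uE h))).
rewrite /differential_mean; congr (_ * _); apply: eq_segint => t.
have [c1 c2 c3] := CR t; rewrite (c3 (J h)) c1 c2.
by move: ('d u _ _) ('d v _ _) (cos t) (sin t) => a b c d; ring.
Qed.

Lemma diff0_cst (f : V -> R) : (forall x, differentiable f x) ->
  (forall x h, 'd f x h = 0) -> forall x, f x = f 0.
Proof.
move=> df f0 x; have [c _] := mvt_line 0 x df.
by rewrite f0 add0r => /eqP; rewrite subr_eq0 => /eqP.
Qed.

(** Cauchy's estimate at [x] bounds the differential by 2 (e' (|x| + 2 r |w|) + C) / r, which is
    small for [e'] small and then [r] large. *)
Lemma liouville_sublinear u v : entire u v ->
  (forall e, 0 < e -> exists2 C, 0 <= C &
    forall z, `|u z| <= e * `|z| + C /\ `|v z| <= e * `|z| + C) ->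
  forall z, u z = u 0.
Proof.
move=> H G; apply: diff0_cst => [x|x w]; first by have [] := H x.
apply/eqP; rewrite -normr_eq0; apply/eqP/le_anti; rewrite normr_ge0 andbT.
apply/ler_addgt0Pr => e e0; rewrite add0r.
have W0 : 0 < 8 * (`|w| + 1) by rewrite mulr_gt0 // ltr_pwDr.
have [C C0 GC] := G (e / (8 * (`|w| + 1))) (divr_gt0 e0 W0).
set e' := e / _ in GC; have e'0 : 0 < e' by rewrite divr_gt0.
(* [e'] makes the part in |w| at most e / 2, and [r] makes the remaining part 2 (e' |x| + C) / r at
   most e / 2. *)
pose r := (e' * `|x| + C) * 4 / e + 1.
have K0 : 0 <= e' * `|x| + C by rewrite addr_ge0 // mulr_ge0 // ltW.
have r0 : 0 < r by rewrite ltr_pwDr // divr_ge0 ?mulr_ge0 // ltW.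
have cx t : `|circle x w r t| <= `|x| + r * (2 * `|w|).
  have -> : circle x w r t = x + (circle x w r t - x) by rewrite [RHS]addrC subrK.
  by apply: le_trans (ler_normD _ _) _; rewrite lerD2l; exact: circle_near.
have b t : e' * `|circle x w r t| + C <= e' * (`|x| + r * (2 * `|w|)) + C.
  by rewrite lerD2r ler_pM2l.
apply: le_trans (cauchy_estimate normJ H r0 (M := e' * (`|x| + r * (2 * `|w|)) + C) _) _.
  by move=> t; have [G1 G2] := GC (circle x w r t); split; apply: le_trans (b t).
rewrite ler_pdivrMr //.
have -> : 2 * (e' * (`|x| + r * (2 * `|w|)) + C) = 2 * (e' * `|x| + C) + 4 * r * (e' * `|w|).
  by move: (e') (`|x|) (`|w|) (r) => e1 a1 a2 a3; ring.
have h1 : 4 * (e' * `|x| + C) <= e * r.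
  have -> : e * r = 4 * (e' * `|x| + C) + e.
    by rewrite /r; move: (e' * `|x| + C) => X; field; rewrite lt0r_neq0.
  by rewrite lerDl ltW.
have h2 : 8 * (e' * `|w|) <= e.
  have W1 : 0 < `|w| + 1 by rewrite ltr_pwDr.
  have -> : 8 * (e' * `|w|) = e * (`|w| / (`|w| + 1)).
    by rewrite /e'; move: (`|w|) W1 => W W1; field; rewrite lt0r_neq0.
  by rewrite ger_pMr // ler_pdivrMr // mul1r lerDl.
have h3 : r * (8 * (e' * `|w|)) <= r * e by rewrite ler_pM2l.
move: h1 h3; move: (e' * `|x| + C) (e' * `|w|) => X Y.
have -> : 4 * r * Y = r * (8 * Y) / 2 by field.
rewrite [e * r]mulrC; move: (r * e) (r * (8 * Y)) => A B; lra.
Qed.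

(** Cauchy's estimate on a circle of radius |x| + 1 around [x] lowers the growth by one degree: the
    differential in a fixed direction is entire and sublinear, hence constant. *)
Theorem liouville_subquadratic u v : entire u v ->
  (forall e, 0 < e -> exists2 C, 0 <= C &
    forall z, `|u z| <= e * `|z| ^+ 2 + C /\ `|v z| <= e * `|z| ^+ 2 + C) ->
  forall z w, 'd u z w = 'd u 0 w.
Proof.
move=> H G z w; apply: (liouville_sublinear (entire_differential w H)).
(* For r = |x| + 1, [r * K] bounds the norm on the circle around [x] with parameters [w] and [r]. *)
move=> e e0; pose K := 1 + 2 * `|w|.
have K1 : 1 <= K by rewrite lerDl mulr_ge0.
have K0 : 0 < K by apply: lt_le_trans K1.
have d0 : 0 < 2 * K ^+ 2 by rewrite mulr_gt0 // exprn_gt0.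
have [C C0 GC] := G (e / (2 * K ^+ 2)) (divr_gt0 e0 d0).
set e' := e / _ in GC; have e'0 : 0 < e' by rewrite divr_gt0.
exists (e + 2 * C); first by rewrite addr_ge0 ?mulr_ge0 // ltW.
move=> x; pose r := `|x| + 1; have r0 : 0 < r by rewrite ltr_pwDr.
have r1 : 1 <= r by rewrite lerDr.
have cx t : `|circle x w r t| <= r * K.
  have -> : circle x w r t = x + (circle x w r t - x) by rewrite [RHS]addrC subrK.
  apply: le_trans (ler_normD _ _) _; rewrite mulrDr mulr1 lerD //; last exact: circle_near.
  by rewrite lerDl.
have cx2 t : e' * `|circle x w r t| ^+ 2 + C <= e' * (r * K) ^+ 2 + C.
  by rewrite lerD2r ler_pM2l // lerXn2r // nnegrE ?mulr_ge0 // ltW.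
have bound : 2 * (e' * (r * K) ^+ 2 + C) / r <= e * `|x| + (e + 2 * C).
  rewrite ler_pdivrMr // mulrDr exprMn /e'.
  have -> : 2 * (e / (2 * K ^+ 2) * (r ^+ 2 * K ^+ 2)) = e * r * r.
    by move: (K) (r) K0 => k s k0; field; rewrite lt0r_neq0.
  have -> : e * `|x| + (e + 2 * C) = e * r + 2 * C by rewrite /r; move: (`|x|) => a; ring.
  by rewrite [(_ + 2 * C) * r]mulrDl lerD2l ler_peMr // mulr_ge0.
split; apply: le_trans bound.
  by apply: (cauchy_estimate normJ H r0) => t; have [G1 G2] := GC (circle x w r t);
    split; apply: le_trans (cx2 t).
by apply: (cauchy_estimate normJ (entire_rot H) r0) => t; rewrite normrN;
  have [G1 G2] := GC (circle x w r t); split; apply: le_trans (cx2 t).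
Qed.

End Liouville.

(** * The Levi form of the logarithm of the norm *)

Section HermitianSpace.
Context {R : realType} {n : nat}.
Local Notation Cn := (Cn R n).
Implicit Types (x y z v w : Cn) (a b : R) (k : 'I_n).

(* The real part of the Hermitian product; the imaginary part of <x, y> is
   [dot x (mulI y)]. *)
Definition dot x y : R := \sum_k (x.1 0 k * y.1 0 k + x.2 0 k * y.2 0 k).

Lemma dotC x y : dot x y = dot y x.
Proof. by apply: eq_bigr => k _; rewrite mulrC [in X in _ + X]mulrC. Qed.

Lemma dot_linearl a x y z : dot (a *: x + y) z = a * dot x z + dot y z.
Proof.
rewrite /dot mulr_sumr -big_split /=; apply: eq_bigr => k _.
by rewrite !mxE; ring.
Qed.

Lemma dotDl x y z : dot (x + y) z = dot x z + dot y z.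
Proof. by have := dot_linearl 1 x y z; rewrite scale1r mul1r. Qed.

Lemma dot0l z : dot 0 z = 0.
Proof. by apply: big1 => k _; rewrite !mxE !mul0r addr0. Qed.

Lemma dotZl a x z : dot (a *: x) z = a * dot x z.
Proof. by have := dot_linearl a x 0 z; rewrite addr0 dot0l addr0. Qed.

Lemma dotNl x z : dot (- x) z = - dot x z.
Proof. by rewrite -scaleN1r dotZl mulN1r. Qed.

Lemma dotDr x y z : dot x (y + z) = dot x y + dot x z.
Proof. by rewrite ![dot x _]dotC dotDl. Qed.

Lemma dotZr a x z : dot x (a *: z) = a * dot x z.
Proof. by rewrite ![dot x _]dotC dotZl. Qed.

Lemma dotNr x z : dot x (- z) = - dot x z.
Proof. by rewrite ![dot x _]dotC dotNl. Qed.

Lemma mulI_linear a x y : mulI (a *: x + y) = a *: mulI x + mulI y.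
Proof. by congr pair; rewrite /= ?opprD ?scalerN. Qed.

Lemma mulIK x : mulI (mulI x) = - x.
Proof. by case: x. Qed.

Lemma mulIZ a x : mulI (a *: x) = a *: mulI x.
Proof. by congr pair; rewrite /= ?scalerN. Qed.

Lemma dot_mulI x y : dot (mulI x) (mulI y) = dot x y.
Proof. by apply: eq_bigr => k _ /=; rewrite !mxE; ring. Qed.

Lemma dot_mulIl x y : dot (mulI x) y = - dot x (mulI y).
Proof. by rewrite -[LHS]dot_mulI mulIK dotNl. Qed.

Lemma dot_mulI_self x : dot x (mulI x) = 0.
Proof. by apply: big1 => k _ /=; rewrite !mxE; ring. Qed.

Lemma dot_ge0 x : 0 <= dot x x.
Proof. by apply: sumr_ge0 => k _; rewrite addr_ge0 // -expr2 sqr_ge0. Qed.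

Lemma dot_eq0 x : dot x x = 0 -> x = 0.
Proof.
move=> /eqP; rewrite psumr_eq0; last first.
  by move=> k _; rewrite addr_ge0 // -expr2 sqr_ge0.
move=> /allP h.
have hk k : x.1 0 k = 0 /\ x.2 0 k = 0.
  have := h k (mem_index_enum k); rewrite -!expr2 /= paddr_eq0 ?sqr_ge0 //.
  by rewrite !sqrf_eq0 => /andP[/eqP -> /eqP ->].
case: x {h} hk => x1 x2 /= hk; congr pair; apply/rowP => k; rewrite mxE;
  by have [] := hk k.
Qed.

Lemma dot_gt0 x : x <> 0 -> 0 < dot x x.
Proof.
by move=> x0; rewrite lt_neqAle dot_ge0 andbT eq_sym; apply/eqP => /dot_eq0.
Qed.

(** The squared length of the difference of the two sides is [dot y y] times the Cauchy-Schwarz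
    defect. For y <> 0 the conclusion makes [x] a complex multiple of [y]. *)
Lemma cauchy_schwarz_eq x y :
  dot x x * dot y y = dot x y ^+ 2 + dot x (mulI y) ^+ 2 ->
  dot y y *: x = dot x y *: y + dot x (mulI y) *: mulI y.
Proof.
move=> E; apply/eqP; rewrite -subr_eq0; apply/eqP/dot_eq0.
rewrite !(dotDl, dotDr, dotNl, dotNr, dotZl, dotZr) dot_mulI dot_mulI_self.
rewrite [dot y x]dotC [dot (mulI y) x]dotC [dot (mulI y) y]dotC dot_mulI_self.
move: E; move: (dot x x) (dot y y) (dot x y) (dot x (mulI y)) => X Y A B E.
transitivity (Y * (X * Y - (A ^+ 2 + B ^+ 2))); first by ring.
by rewrite E subrr mulr0.
Qed.

Lemma hnormE x : hnorm x = Num.sqrt (dot x x).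
Proof. by []. Qed.

Lemma norm_mulI x : `|mulI x| <= `|x|.
Proof. by rewrite !prod_normE /= normrN maxC. Qed.

Lemma coord_norm_le (x : 'rV[R]_n) k : `|x 0 k| <= `|x|.
Proof.
rewrite [leRHS]/Num.norm /= mx_normrE.
exact: (le_bigmax _ (fun ij => `|x ij.1 ij.2|) (0, k)).
Qed.

(** Here |x| is the maximum norm of the 2 n real coordinates, not [hnorm], so the bound is made
    coordinate by coordinate. *)
Lemma dot_norm_le y : exists2 C, 0 <= C & forall x, `|dot x y| <= C * `|x|.
Proof.
exists (\sum_k (`|y.1 0 k| + `|y.2 0 k|)).
  by apply: sumr_ge0 => k _; rewrite addr_ge0.
move=> x; rewrite mulr_suml; apply: le_trans (ler_norm_sum _ _ _) _.
apply: ler_sum => k _; apply: le_trans (ler_normD _ _) _.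
rewrite !normrM mulrDl; apply: lerD; rewrite mulrC ler_wpM2l //;
  apply: le_trans (coord_norm_le _ _) _.
  by rewrite prod_normE le_max lexx.
by rewrite prod_normE le_max lexx orbT.
Qed.

Lemma is_diff_dotl y z : is_diff z (fun x => dot x y) (fun x => dot x y).
Proof.
have [C C0 HC] := dot_norm_le y.
apply: (@is_diff_quadratic R Cn _ _ z C 1) => //.
  by move=> a u v; rewrite dot_linearl.
move=> h _; rewrite dotDl [dot z y + _]addrC addrK.
by rewrite subrr normr0 mulr_ge0 // exprn_ge0.
Qed.

Lemma dot_ex x k : dot x (ex R k) = x.1 0 k.
Proof.
rewrite /dot (bigD1 k) //= !mxE !eqxx mulr1 mulr0 addr0 big1 ?addr0 // => i ik.
by rewrite !mxE (negPf ik) andbF !mulr0 addr0.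
Qed.

Lemma dot_ey x k : dot x (ey R k) = x.2 0 k.
Proof.
rewrite /dot (bigD1 k) //= !mxE !eqxx mulr1 mulr0 add0r big1 ?addr0 // => i ik.
by rewrite !mxE (negPf ik) andbF !mulr0 addr0.
Qed.

Lemma mulI_ex k : mulI (ex R k) = ey R k.
Proof. by congr pair; rewrite /= ?oppr0. Qed.

Lemma Cn_decomp x : x = \sum_k (x.1 0 k *: ex R k + x.2 0 k *: ey R k).
Proof.
rewrite [LHS]surjective_pairing [RHS]surjective_pairing.
rewrite (raddf_sum fst) (raddf_sum snd) /=.
congr pair; apply/rowP => j; rewrite summxE (bigD1 j) //= !mxE !eqxx /=.
  rewrite mulr1 mulr0 addr0 big1 ?addr0 // => i ij.
  by rewrite !mxE eq_sym (negPf ij) andbF !mulr0 addr0.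
rewrite mulr1 mulr0 add0r big1 ?addr0 // => i ij.
by rewrite !mxE eq_sym (negPf ij) andbF !mulr0 addr0.
Qed.

Lemma linear_basis_expansion (W : lmodType R) (L : Cn -> W) :
  (forall a x y, L (a *: x + y) = a *: L x + L y) ->
  forall x, L x = \sum_k (x.1 0 k *: L (ex R k) + x.2 0 k *: L (ey R k)).
Proof.
move=> hL x; have L0 : L 0 = 0.
  by have := hL 1 0 0; rewrite !scale1r addr0 => /eqP; rewrite addrC -subr_eq subrr => /eqP.
have LD p q : L (p + q) = L p + L q by have := hL 1 p q; rewrite !scale1r.
rewrite {1}[x]Cn_decomp (big_morph L LD L0); apply: eq_bigr => k _.
by rewrite hL; have := hL (x.2 0 k) (ey R k) 0; rewrite L0 !addr0 => ->.
Qed.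

Lemma linear_eq_on_basis (W : lmodType R) (L M : Cn -> W) :
  (forall a x y, L (a *: x + y) = a *: L x + L y) ->
  (forall a x y, M (a *: x + y) = a *: M x + M y) ->
  (forall k, L (ex R k) = M (ex R k) /\ L (ey R k) = M (ey R k)) ->
  forall x, L x = M x.
Proof.
move=> hL hM hk x; rewrite (linear_basis_expansion hL) (linear_basis_expansion hM).
by apply: eq_bigr => k _; have [-> ->] := hk k.
Qed.

End HermitianSpace.

(** * Hessian of the logarithm of the norm *)

Section LeviForm.
Context {R : realType} {n : nat}.
Local Notation Cn := (Cn R n).
Implicit Types (F : Cn -> Cn) (z v w e : Cn) (k : 'I_n).

Lemma holomorphic_dotl F y z : holomorphic F ->
  is_diff z (fun x => dot (F x) y) (fun h => dot ('d F z h) y).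
Proof.
move=> H; have [dF _] := H z.
exact: (is_diff_compfun (differentiableP dF) (is_diff_dotl y (F z))).
Qed.

Lemma holomorphic_mulI F z w : holomorphic F -> 'd F z (mulI w) = mulI ('d F z w).
Proof.
move=> H; have [dF CR] := H z; move: w.
apply: linear_eq_on_basis => [a x y|a x y|k].
- by rewrite mulI_linear; exact: (linearP ('d F z)).
- by rewrite -mulI_linear; congr mulI; exact: (linearP ('d F z)).
have dx : 'd F z (ex R k) = 'D_(ex R k) F z by rewrite deriveE.
have dy : 'd F z (ey R k) = 'D_(ey R k) F z by rewrite deriveE.
have Ek : 'd F z (ey R k) = mulI ('d F z (ex R k)) by rewrite dx dy; exact: CR.
split; first by rewrite mulI_ex.
rewrite -mulI_ex mulIK mulI_ex Ek mulIK.
exact: (linearN ('d F z)).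
Qed.

(** Pairing with a fixed vector reduces the map [F] to scalar functions, to which Cauchy's formula
    applies. *)
Lemma holomorphic_entire F y : holomorphic F ->
  @entire R Cn (@mulI R n) (fun x => dot (F x) y) (fun x => dot (F x) (mulI y)).
Proof.
move=> H z; have [du uE] := holomorphic_dotl y z H.
have [dv vE] := holomorphic_dotl (mulI y) z H.
split; [exact: du|exact: dv|move=> w].
rewrite uE vE (holomorphic_mulI z w H); split.
  exact: dot_mulIl.
exact: dot_mulI.
Qed.

Lemma is_diff_sumfun (m : nat) (f df : 'I_m -> Cn -> R) z :
  (forall i, is_diff z (f i) (df i)) ->
  is_diff z (fun x => \sum_i f i x) (fun h => \sum_i df i h).
Proof.
move=> H; elim: (index_enum _) => [|i r ih].
  have E (g : 'I_m -> Cn -> R) : (fun x => \sum_(j <- [::]) g j x) = cst 0.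
    by apply/funext => x; rewrite big_nil.
  by rewrite !E; exact: is_diff_cst.
have E (g : 'I_m -> Cn -> R) : (fun x => \sum_(j <- i :: r) g j x) =
    (fun x => g i x + \sum_(j <- r) g j x).
  by apply/funext => x; rewrite big_cons.
by rewrite !E; exact: is_diffDfun.
Qed.

(** A product rule in which derivatives are known only through pairings with fixed vectors [y]:
    second derivatives of [F] are obtained in this form. *)
Lemma is_diff_dot (f g : Cn -> Cn) (Df Dg : Cn -> Cn -> R) z :
  (forall y, is_diff z (fun x => dot (f x) y) (Df y)) ->
  (forall y, is_diff z (fun x => dot (g x) y) (Dg y)) ->
  (forall a x y h, Df (a *: x + y) h = a * Df x h + Df y h) ->
  (forall a x y h, Dg (a *: x + y) h = a * Dg x h + Dg y h) ->
  is_diff z (fun x => dot (f x) (g x)) (fun h => Df (g z) h + Dg (f z) h).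
Proof.
move=> hf hg lf lg.
have comp (h : Cn -> Cn) dh k : (forall y, is_diff z (fun x => dot (h x) y) (dh y)) ->
    is_diff z (fun x => (h x).1 0 k) (dh (ex R k)) /\
    is_diff z (fun x => (h x).2 0 k) (dh (ey R k)).
  move=> hh; have := hh (ex R k); have := hh (ey R k).
  have -> : (fun x => dot (h x) (ex R k)) = (fun x => (h x).1 0 k).
    by apply/funext => x; rewrite dot_ex.
  have -> : (fun x => dot (h x) (ey R k)) = (fun x => (h x).2 0 k).
    by apply/funext => x; rewrite dot_ey.
  by [].
have key k : is_diff z
    (fun x => (f x).1 0 k * (g x).1 0 k + (f x).2 0 k * (g x).2 0 k)
    (fun h => (f z).1 0 k * Dg (ex R k) h + (g z).1 0 k * Df (ex R k) h +
      ((f z).2 0 k * Dg (ey R k) h + (g z).2 0 k * Df (ey R k) h)).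
  have [f1 f2] := comp f Df k hf; have [g1 g2] := comp g Dg k hg.
  exact: (is_diffDfun (is_diffMfun f1 g1) (is_diffMfun f2 g2)).
apply: (is_diff_eq (is_diff_sumfun key)).
apply/funext => h.
rewrite (linear_basis_expansion (W := R^o) (fun a x y => lf a x y h)).
rewrite (linear_basis_expansion (W := R^o) (fun a x y => lg a x y h)).
by rewrite -big_split /=; apply: eq_bigr => k _; rewrite /GRing.scale /=; ring.
Qed.

(** Pairing with [y] of the second derivative of [F] at [z], taken along [e] and then [v]. *)
Definition hess F z e y v : R := 'd (fun x => dot ('d F x e) y) z v.

Lemma entire_dot_differential F e y : holomorphic F ->
  @entire R Cn (@mulI R n) (fun x => dot ('d F x e) y)
    (fun x => dot ('d F x e) (mulI y)).
Proof.
move=> H; have E := entire_differential norm_mulI e (holomorphic_entire y H).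
have dE y' : (fun x => dot ('d F x e) y') = (fun x => 'd (fun x => dot (F x) y') x e).
  by apply/funext => x; rewrite (is_diff_val _ (holomorphic_dotl y' x H)).
by rewrite (dE y) (dE (mulI y)).
Qed.

Lemma hess_is_diff F z e y : holomorphic F ->
  is_diff z (fun x => dot ('d F x e) y) (hess F z e y).
Proof.
move=> H; have [d _ _] := entire_dot_differential e y H z.
exact: differentiableP.
Qed.

Lemma hess_linear_vec F z e a y y' v : holomorphic F ->
  hess F z e (a *: y + y') v = a * hess F z e y v + hess F z e y' v.
Proof.
move=> H; rewrite {1}/hess.
have h := is_diffDfun (is_diffMfun (is_diff_cst a z) (hess_is_diff z e y H))
   (hess_is_diff z e y' H).
have -> : (fun x => dot ('d F x e) (a *: y + y')) =
    (fun x => cst a x * dot ('d F x e) y + dot ('d F x e) y').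
  by apply/funext => x; rewrite dotDr dotZr.
by rewrite (is_diff_val v h) /= mulr0 addr0.
Qed.

Lemma hess_linear_dir F z e y a v v' : hess F z e y (a *: v + v') =
  a * hess F z e y v + hess F z e y v'.
Proof. exact: (linearP ('d (fun x => dot ('d F x e) y) z)). Qed.

Lemma differential_linear F z a v v' :
  'd F z (a *: v + v') = a *: 'd F z v + 'd F z v'.
Proof. exact: (linearP ('d F z)). Qed.

Lemma hess_linear_fst F z e e' a y v : holomorphic F ->
  hess F z (a *: e + e') y v = a * hess F z e y v + hess F z e' y v.
Proof.
move=> H; rewrite {1}/hess.
have h := is_diffDfun (is_diffMfun (is_diff_cst a z) (hess_is_diff z e y H))
   (hess_is_diff z e' y H).
have -> : (fun x => dot ('d F x (a *: e + e')) y) =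
    (fun x => cst a x * dot ('d F x e) y + dot ('d F x e') y).
  by apply/funext => x; rewrite differential_linear dotDl dotZl.
by rewrite (is_diff_val v h) /= mulr0 addr0.
Qed.

(** The second derivative of a holomorphic map is complex bilinear, and i^2 = -1. This is what
    removes second derivatives from the Levi form. *)
Lemma hess_mulI F z v y : holomorphic F ->
  hess F z (mulI v) y (mulI v) = - hess F z v y v.
Proof.
move=> H; rewrite {1}/hess.
have -> : (fun x => dot ('d F x (mulI v)) y) =
    (fun x => - dot ('d F x v) (mulI y)).
  by apply/funext => x; rewrite (holomorphic_mulI x v H) dot_mulIl.
have [_ dv /(_ v) [_ CR]] := entire_dot_differential v y H z.
have h := is_diffN (differentiableP dv).
rewrite (is_diff_val (mulI v) h); congr (- _); exact: CR.
Qed.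

Definition sqn F z : R := dot (F z) (F z).

Lemma sqn_is_diff F z : holomorphic F ->
  is_diff z (sqn F) (fun h => 2 * dot (F z) ('d F z h)).
Proof.
move=> H; have hF y := holomorphic_dotl y z H.
have lin a x y h : dot ('d F z h) (a *: x + y) = a * dot ('d F z h) x + dot ('d F z h) y.
  by rewrite dotDr dotZr.
apply: (is_diff_eq (is_diff_dot hF hF lin lin)).
by apply/funext => h; rewrite [dot (F z) _]dotC mulr_natl mulr2n.
Qed.

Lemma ln_hnorm (x : Cn) : ln (hnorm x) = 2^-1 * ln (dot x x).
Proof.
(* At x = 0 both sides are 0, by the default value of [ln] at 0. *)
rewrite hnormE; have := dot_ge0 x; rewrite le_eqVlt => /predU1P[<-|x0].
  by rewrite sqrtr0 !ln0 ?mulr0.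
rewrite -{2}(sqr_sqrtr (ltW x0)) lnXn ?sqrtr_gt0 // mulrnAr -mulr_natr.
by field.
Qed.

Lemma ln_hnorm_is_diff F z : holomorphic F -> F z <> 0 ->
  is_diff z (fun x => ln (hnorm (F x))) (fun h => dot (F z) ('d F z h) / sqn F z).
Proof.
move=> H Fz; have N0 : 0 < sqn F z by exact: dot_gt0.
have hln := is_diff_derive_comp (sqn_is_diff z H) (is_derive1_ln N0).
have h := is_diffMfun (is_diff_cst (2^-1 : R) z) hln.
have -> : (fun x => ln (hnorm (F x))) = (fun x => cst (2^-1 : R) x * ln (sqn F x)).
  by apply/funext => x; rewrite ln_hnorm.
apply: (is_diff_eq h); apply/funext => k /=; rewrite mulr0 addr0.
by rewrite !mulrA mulVf // mul1r.
Qed.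

(** Real Hessian of [ln (hnorm (F z))], first along [e], then along [v]. *)
Definition log_hess F z v e : R :=
  (dot ('d F z v) ('d F z e) + hess F z e (F z) v) / sqn F z -
  2 * (dot (F z) ('d F z e) * dot (F z) ('d F z v)) / sqn F z ^+ 2.

Lemma log_hess_is_diff F z e : holomorphic F -> F z <> 0 ->
  is_diff z (fun x => dot (F x) ('d F x e) / sqn F x) (log_hess F z ^~ e).
Proof.
move=> H Fz; have N0 : 0 < sqn F z by exact: dot_gt0.
have hF y := holomorphic_dotl y z H.
have lin a x y h : dot ('d F z h) (a *: x + y) = a * dot ('d F z h) x + dot ('d F z h) y.
  by rewrite dotDr dotZr.
have hd := is_diff_dot hF (fun y => hess_is_diff z e y H) lin
  (fun a x y h => hess_linear_vec z e a x y h H).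
have [dN NE] := sqn_is_diff z H.
have hV : is_diff z (fun x => (sqn F x)^-1)
    (fun h => - sqn F z ^- 2 * (2 * dot (F z) ('d F z h))).
  split; first by apply: differentiableV; [exact: dN|exact: lt0r_neq0].
  by apply/funext => h; rewrite (diffV dN (lt0r_neq0 N0)) /= NE.
apply: (is_diff_eq (is_diffMfun hd hV)); apply/funext => h; rewrite /log_hess.
move: (sqn F z) N0 (dot _ _) (dot _ _) (dot _ _) (hess _ _ _ _ _) => N N0 A B C D.
by field; rewrite lt0r_neq0.
Qed.

End LeviForm.

(** * Comparison of two Levi forms *)

Section LeviComparison.
Context {R : realType} {n : nat}.
Local Notation Cn := (Cn R n).
Implicit Types (F G : Cn -> Cn) (z v w e : Cn) (k : 'I_n).

(** The hypotheses are the vanishing of the real and imaginary parts of the entries of a Levi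
    matrix. They give B v e + B (i v) (i e) = 0 on the real basis, and bilinearity extends it to all
    pairs, in particular to e = v. *)
Lemma bilinear_levi_vanish (B : Cn -> Cn -> R) :
  (forall a v v' e, B (a *: v + v') e = a * B v e + B v' e) ->
  (forall a v e e', B v (a *: e + e') = a * B v e + B v e') ->
  (forall i j, B (ex R i) (ex R j) + B (ey R i) (ey R j) = 0 /\
               B (ex R i) (ey R j) = B (ey R i) (ex R j)) ->
  forall v, B v v + B (mulI v) (mulI v) = 0.
Proof.
move=> Bl Br Bb v.
have BN v' e : B (- v') e = - B v' e.
  have B0 : B 0 e = 0 by have := Bl 1 0 0 e; rewrite scale1r addr0; lra.
  by have := Bl (-1) v' 0 e; rewrite scaleN1r addr0 B0; lra.
have BrN v' e : B v' (- e) = - B v' e.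
  have B0 : B v' 0 = 0 by have := Br 1 v' 0 0; rewrite scale1r addr0; lra.
  by have := Br (-1) v' e 0; rewrite scaleN1r addr0 B0; lra.
have ind e (W := fun v => B v e + B (mulI v) (mulI e)) :
    (forall k, W (ex R k) = 0 /\ W (ey R k) = 0) -> forall v, W v = 0.
  apply: (@linear_eq_on_basis _ _ R^o W (fun=> 0)) => a x y; last by rewrite scaler0 addr0.
  by rewrite /W mulI_linear !Bl /GRing.scale /=; ring.
apply: (ind v) => k; split.
  apply: (@linear_eq_on_basis _ _ R^o
    (fun e => B (ex R k) e + B (mulI (ex R k)) (mulI e)) (fun=> 0)).
  - by move=> a x y; rewrite mulI_linear !Br /GRing.scale /=; ring.
  - by move=> a x y; rewrite scaler0 addr0.
  move=> j; rewrite -!mulI_ex !mulIK !BrN !mulI_ex.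
  by have [-> ->] := Bb k j; split=> //; rewrite subrr.
apply: (@linear_eq_on_basis _ _ R^o
  (fun e => B (ey R k) e + B (mulI (ey R k)) (mulI e)) (fun=> 0)).
- by move=> a x y; rewrite mulI_linear !Br /GRing.scale /=; ring.
- by move=> a x y; rewrite scaler0 addr0.
move=> j; rewrite -!mulI_ex !mulIK !BrN !BN !mulI_ex opprK.
by have [h1 ->] := Bb k j; split; [rewrite subrr|rewrite addrC].
Qed.

(* The Levi form of [ln (hnorm F)] is the Fubini-Study form pulled back by [F]:
   up to the factor [4], its value at [v] is the defect in the Cauchy-Schwarz
   inequality for [F z] and ['d F z v], divided by [|F z|^4]. *)
Definition schwarz_defect F z v : R :=
  (sqn F z * dot ('d F z v) ('d F z v) - dot (F z) ('d F z v) ^+ 2 -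
   dot (F z) (mulI ('d F z v)) ^+ 2) / sqn F z ^+ 2.

(** The terms in [hess] at [v] and at [mulI v] cancel, leaving first derivatives only. *)
Lemma log_hess_diag F z v : holomorphic F -> F z <> 0 ->
  log_hess F z v v + log_hess F z (mulI v) (mulI v) = 2 * schwarz_defect F z v.
Proof.
move=> H Fz; have N0 : 0 < sqn F z by exact: dot_gt0.
rewrite /log_hess /schwarz_defect (hess_mulI z v (F z) H).
rewrite (holomorphic_mulI z v H) dot_mulI.
move: (sqn F z) N0 (dot ('d F z v) ('d F z v)) (dot (F z) ('d F z v)).
move: (dot (F z) (mulI ('d F z v))) (hess F z v (F z) v).
by move=> C D N N0 A B; field; rewrite lt0r_neq0.
Qed.

Lemma log_hess_linear_dir F z a v v' e : log_hess F z (a *: v + v') e =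
  a * log_hess F z v e + log_hess F z v' e.
Proof.
rewrite /log_hess differential_linear hess_linear_dir.
rewrite [dot (a *: _ + _) _]dot_linearl [dot (F z) (a *: _ + _)]dotDr dotZr.
move: (sqn F z)^-1 => N.
move: (dot _ _) (dot _ _) (dot _ _) (dot _ _) (dot _ _) (hess _ _ _ _ _) (hess _ _ _ _ _).
move=> *; ring.
Qed.

Lemma log_hess_linear_fst F z a v e e' : holomorphic F ->
  log_hess F z v (a *: e + e') = a * log_hess F z v e + log_hess F z v e'.
Proof.
move=> H; rewrite /log_hess differential_linear (hess_linear_fst _ _ _ _ _ _ H).
rewrite !dotDr !dotZr.
move: (sqn F z)^-1 => N.
move: (dot _ _) (dot _ _) (dot _ _) (dot _ _) (dot _ _) (hess _ _ _ _ _) (hess _ _ _ _ _).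
move=> *; ring.
Qed.

Lemma levi_eq0_entries (g : Cn -> R) z i j : levi g z = 0 ->
  dX i (dX j g) z + dY i (dY j g) z = 0 /\ dX i (dY j g) z = dY i (dX j g) z.
Proof.
move=> L0; have : levi g z i j = 0 by rewrite L0 mxE.
rewrite mxE => -[] /eqP; rewrite mulf_eq0 invr_eq0 pnatr_eq0 orbF => /eqP e1.
move=> /eqP; rewrite mulf_eq0 invr_eq0 pnatr_eq0 orbF subr_eq0 => /eqP e2.
by split; [exact: e1|exact: e2].
Qed.

(** The Levi matrix constrains the difference of the two real Hessians; its values at [v] and
    [mulI v] add up to twice the difference of the defects. *)
Lemma pluriharmonic_schwarz_defect F G : holomorphic F -> holomorphic G ->
  (forall z, z <> 0 -> F z <> 0) -> (forall z, z <> 0 -> G z <> 0) ->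
  pluriharmonic_on (~` [set 0]) (fun z => ln (hnorm (F z)) - ln (hnorm (G z))) ->
  forall z v, z <> 0 -> schwarz_defect F z v = schwarz_defect G z v.
Proof.
move=> HF HG F0 G0 [oU [_ L0]] z v z0.
set g := fun z => _ in L0.
have dg e x : x <> 0 -> 'D_e g x =
    dot (F x) ('d F x e) / sqn F x - dot (G x) ('d G x e) / sqn G x.
  move=> x0; have h := is_diffBfun (ln_hnorm_is_diff HF (F0 _ x0))
    (ln_hnorm_is_diff HG (G0 _ x0)).
  by have [d E] := h; rewrite deriveE // E.
have ddg w e : 'D_w (fun x => 'D_e g x) z = log_hess F z w e - log_hess G z w e.
  have -> : 'D_w (fun x => 'D_e g x) z = 'D_w (fun x => dot (F x) ('d F x e) / sqn F x -
      dot (G x) ('d G x e) / sqn G x) z.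
    (* The formula for the first derivative holds off 0, which is a neighbourhood of [z]. *)
    apply: near_eq_derive; have : nbhs z (~` [set 0 : Cn]) by apply: open_nbhs_nbhs.
    by apply: filterS => x x0; apply: dg.
  have h := is_diffBfun (log_hess_is_diff e HF (F0 _ z0)) (log_hess_is_diff e HG (G0 _ z0)).
  by have [d E] := h; rewrite deriveE // E.
have := @bilinear_levi_vanish (fun w e => log_hess F z w e - log_hess G z w e).
move=> /(_ _ _ _ v) => B.
have {}B : log_hess F z v v - log_hess G z v v +
   (log_hess F z (mulI v) (mulI v) - log_hess G z (mulI v) (mulI v)) = 0.
  apply: B.
  - move=> a x y e; rewrite !log_hess_linear_dir.
    by move: (log_hess _ _ _ _) (log_hess _ _ _ _) (log_hess _ _ _ _) (log_hess _ _ _ _) => *; ring.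
  - move=> a w e e'; rewrite (log_hess_linear_fst _ _ _ _ _ HF) (log_hess_linear_fst _ _ _ _ _ HG).
    by move: (log_hess _ _ _ _) (log_hess _ _ _ _) (log_hess _ _ _ _) (log_hess _ _ _ _) => *; ring.
  move=> i j; rewrite -!ddg.
  by have [e1 e2] := levi_eq0_entries i j (L0 z z0); split; [exact: e1|exact: e2].
have hF := log_hess_diag v HF (F0 _ z0); have hG := log_hess_diag v HG (G0 _ z0).
move: B hF hG; move: (log_hess F z v v) (log_hess F z _ _) (log_hess G z v v) (log_hess G z _ _).
by move: (schwarz_defect F z v) (schwarz_defect G z v) => A B C D E I; lra.
Qed.

End LeviComparison.

(** * Preservation of complex lines *)

Section RadialRigidity.
Context {R : realType} {n : nat}.
Local Notation Cn := (Cn R n).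
Implicit Types (a v w x y : Cn).

Lemma cauchy_schwarz x y :
  dot x y ^+ 2 + dot x (mulI y) ^+ 2 <= dot x x * dot y y.
Proof.
have [-> | /eqP y0] := eqVneq y 0.
  have -> : mulI (0 : Cn) = 0 by congr pair; rewrite /= ?oppr0.
  by rewrite ![dot x 0]dotC !dot0l expr0n addr0 mulr0.
have := dot_ge0 (dot y y *: x - (dot x y *: y + dot x (mulI y) *: mulI y)).
rewrite !(dotDl, dotDr, dotNl, dotNr, dotZl, dotZr) dot_mulI dot_mulI_self.
rewrite [dot y x]dotC [dot (mulI y) x]dotC [dot (mulI y) y]dotC dot_mulI_self.
have := dot_gt0 y0.
move: (dot x x) (dot y y) (dot x y) (dot x (mulI y)) => X Y A B Y0 E.
rewrite -subr_ge0 -(pmulr_rge0 _ Y0); apply: le_trans E _.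
by rewrite le_eqVlt; apply/orP; left; apply/eqP; ring.
Qed.

(** Each of the 2 n real coordinates is bounded by the maximum norm. *)
Lemma dot_self_le x : dot x x <= n.*2%:R * `|x| ^+ 2.
Proof.
apply: (@le_trans _ _ (\sum_(k < n) (2 * `|x| ^+ 2))); last first.
  by rewrite sumr_const card_ord -[X in X <= _]mulr_natl -muln2 natrM mulrA.
apply: ler_sum => k _; rewrite mulr_natl mulr2n -!expr2.
have b (r : R) : `|r| <= `|x| -> r ^+ 2 <= `|x| ^+ 2.
  by move=> rx; rewrite -real_normK ?num_real // lerXn2r // nnegrE.
apply: lerD; apply: b; apply: le_trans (coord_norm_le _ _) _.
  by rewrite prod_normE le_max lexx.
by rewrite prod_normE le_max lexx orbT.
Qed.

Variable Phi : Cn -> Cn.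
Hypothesis holPhi : holomorphic Phi.
Hypothesis Phi0 : Phi 0 = 0.
Hypothesis dPhi0 : forall v, 'd Phi 0 v = v.
Hypothesis Phi_neq0 : forall w, w <> 0 -> Phi w <> 0.

(** One point of the ray for each [e] suffices, because the quantity evaluated there is constant
    along the ray. *)
Lemma near_identity a e : 0 < e -> exists2 s, 0 < s < 1 &
  `|Phi (s *: a) - s *: a| <= e * s.
Proof.
move=> e0; have a1 : 0 < `|a| + 1 by rewrite ltr_pwDr.
have [dP _] := holPhi 0.
have [d d0 dE] := differentiable_approx dP (divr_gt0 e0 a1).
pose s := Num.min 2^-1 (d / (`|a| + 1) / 2).
have s0 : 0 < s by rewrite lt_min invr_gt0 ltr0n !divr_gt0.
exists s; first by rewrite s0 gt_min; apply/orP; left; lra.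
have sn : `|s *: a| = s * `|a| by rewrite normrZ gtr0_norm.
have sd : s * `|a| < d.
  by apply: scaled_lt s0 _ d0 _; rewrite // ge_min lexx orbT.
have := dE (s *: a); rewrite add0r Phi0 subr0 dPhi0 sn => /(_ sd) h.
apply: le_trans h _; rewrite -mulrA ler_pM2l // mulrC ler_pdivrMr // ler_pM2l //.
by rewrite lerDl.
Qed.

Hypothesis radial : forall w, w <> 0 -> exists l m : R,
  sqn Phi w *: 'd Phi w w = l *: Phi w + m *: mulI (Phi w).

Lemma ray_is_derive (f : Cn -> R) df a (s : R) : is_diff (s *: a) f df ->
  is_derive s (1 : R) (fun s => f (s *: a)) (df a).
Proof.
move=> [d E]; have d' : differentiable f (0 + s *: a) by rewrite add0r.
have := line_is_derive d'; rewrite add0r E.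
by have -> : (fun s => f (0 + s *: a)) = (fun s => f (s *: a));
  first by apply/funext => t; rewrite add0r.
Qed.

Lemma is_derive_inv (f : R -> R) (s df : R) : 0 < f s ->
  is_derive s (1 : R) f df ->
  is_derive s (1 : R) (fun t => (f t)^-1) (- (f s) ^- 2 * df).
Proof.
move=> f0 [d E]; split; first exact: (derivableV (lt0r_neq0 f0) d).
by rewrite (deriveV (lt0r_neq0 f0) d) E.
Qed.

(** |<Phi (s a), a>|^2 / |Phi (s a)|^2, that is |a|^2 times the squared cosine of the Hermitian
    angle between [a] and [Phi (s *: a)]. *)
Let T a (s : R) := (dot (Phi (s *: a)) a * dot (Phi (s *: a)) a +
   dot (Phi (s *: a)) (mulI a) * dot (Phi (s *: a)) (mulI a)) * (sqn Phi (s *: a))^-1.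

(** The derivative of Phi (s a) in [s] is a complex multiple of Phi (s a), so differentiation
    multiplies the numerator and the denominator of [T] by the same number, twice the real part of
    that factor. *)
Let T_is_derive a (s : R) : a <> 0 -> 0 < s -> is_derive s (1 : R) (T a) 0.
Proof.
move=> a0 s0; pose w := s *: a; have sn0 := lt0r_neq0 s0.
have w0 : w <> 0.
  by move=> /eqP; rewrite scaler_eq0 (negPf sn0) => /eqP.
have N0 : 0 < sqn Phi w by apply: dot_gt0; exact: Phi_neq0.
have dP := ray_is_derive (holomorphic_dotl a w holPhi).
have dQ := ray_is_derive (holomorphic_dotl (mulI a) w holPhi).
have dN := ray_is_derive (sqn_is_diff w holPhi).
have dV : is_derive s (1 : R) (fun s => (sqn Phi (s *: a))^-1)
    (- (sqn Phi w) ^- 2 * (2 * dot (Phi w) ('d Phi w a))).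
  exact: (is_derive_inv N0 dN).
have := is_deriveM (is_deriveD (is_deriveM dP dP) (is_deriveM dQ dQ)) dV.
rewrite -/w => h; apply: (is_derive_eq h) => {h dP dQ dN dV}.
rewrite /GRing.scale /=.
have [l [m E]] := radial w0.
have aE : 'd Phi w a = s^-1 *: 'd Phi w w.
  have wE : 'd Phi w w = s *: 'd Phi w a.
    have := differential_linear Phi w s a 0.
    by rewrite addr0 (linear0 ('d Phi w)) addr0; exact.
  apply: (scalerI sn0); rewrite scalerA mulfV // scale1r; exact: (esym wE).
move: aE; move: ('d Phi w w) ('d Phi w a) E => dww dwa E aE.
have dE y : dot dwa y = (l * dot (Phi w) y - m * dot (Phi w) (mulI y)) / (s * sqn Phi w).
  have : dot (sqn Phi w *: dww) y = l * dot (Phi w) y - m * dot (Phi w) (mulI y).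
    by rewrite E dotDl !dotZl dot_mulIl mulrN.
  rewrite aE !dotZl => <-; move: (dot _ y) (sqn Phi w) N0 => D N N0.
  by field; rewrite sn0 lt0r_neq0.
rewrite [dot (Phi w) dwa]dotC !dE mulIK dotNr dot_mulI_self -/(sqn Phi w).
rewrite -[X in X * _ + _ = _]/(dot (Phi w) a * dot (Phi w) a +
  dot (Phi w) (mulI a) * dot (Phi w) (mulI a)).
move: (sqn Phi w) N0 (dot (Phi w) a) (dot (Phi w) (mulI a)) => N N0 P Q.
by field; rewrite sn0 lt0r_neq0.
Qed.

(** [T a] is at most [dot a a] times [dot a a] over itself, by Cauchy-Schwarz, and tends to
    [dot a a] at 0, as Phi (s a) / s tends to [a]. Being constant it equals [dot a a] at s = 1,
    which is equality in Cauchy-Schwarz. *)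
Lemma radial_direction a :
  dot (Phi a) (Phi a) * dot a a = dot (Phi a) a ^+ 2 + dot (Phi a) (mulI a) ^+ 2.
Proof.
have [-> | /eqP a0] := eqVneq a 0; first by rewrite Phi0 !dot0l expr0n addr0 mul0r.
have A0 := dot_gt0 a0; have N0 : 0 < sqn Phi a by apply: dot_gt0; exact: Phi_neq0.
have Tcst s : 0 < s < 1 -> T a s = T a 1.
  move=> /andP[s0 s1].
  have d (r : R) : r \in `]s, 1[ -> is_derive r (1 : R) (T a) 0.
    by rewrite in_itv /= => /andP[sx _]; apply: T_is_derive => //; apply: lt_trans sx.
  have c : {within `[s, 1], continuous (T a)}.
    apply: derivable_within_continuous => r; rewrite in_itv /= => /andP[sx _].
    by have [] := T_is_derive a0 (lt_le_trans s0 sx).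
  have [y _] := MVT_segment (ltW s1) d c.
  by rewrite mul0r => /eqP; rewrite subr_eq0 => /eqP ->.
(* The gap in Cauchy-Schwarz. Multiplied by [sqn Phi (s *: a)] it is the defect of Phi (s a) against
   [a]. *)
pose c := dot a a - T a 1.
have cN s : 0 < s < 1 -> c * sqn Phi (s *: a) = dot (Phi (s *: a)) (Phi (s *: a)) * dot a a -
    dot (Phi (s *: a)) a ^+ 2 - dot (Phi (s *: a)) (mulI a) ^+ 2.
  move=> s01; have s0 : 0 < s by case/andP: s01.
  have w0 : s *: a <> 0.
    by move=> /eqP; rewrite scaler_eq0 (negPf (lt0r_neq0 s0)) => /eqP.
  have Ns : 0 < sqn Phi (s *: a) by apply: dot_gt0; exact: Phi_neq0.
  rewrite /c -(Tcst s s01) /T -/(sqn Phi (s *: a)).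
  move: (sqn Phi _) Ns (dot _ (mulI a)) (dot _ a) (dot a a) => *.
  by field; rewrite lt0r_neq0.
suff c0 : c <= 0.
  apply/le_anti; rewrite cauchy_schwarz andbT.
  move: c0; rewrite /c /T scale1r subr_le0 ler_pdivlMr //.
  by rewrite -!expr2 mulrC.
have [C C0 HC] := dot_norm_le a.
apply/ler_addgt0Pr => r r0; rewrite add0r.
(* The 4 comes from the lower bound [lowN], and 2 n from [dot_self_le]. *)
pose K : R := 4 * n.*2%:R + 1; have K0 : 0 < K by rewrite ltr_pwDr // mulr_ge0.
have C1 : 0 < C + 1 by rewrite ltr_pwDr.
(* The three bounds give in turn [e ^+ 2 <= e], the lower bound for [dot f a], and [K * e <= r]. *)
pose e := Num.min 1 (Num.min (dot a a / (C + 1) / 2) (r / K)).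
have e0 : 0 < e by rewrite !lt_min ltr01 !divr_gt0.
have e1 : e <= 1 by rewrite ge_min lexx.
have e2 : e <= dot a a / (C + 1) / 2 by rewrite !ge_min lexx orbT.
have e3 : e <= r / K by rewrite !ge_min lexx !orbT.
have [s s01 hs] := near_identity a e0; have cNs := cN s s01.
have [s0 s1] := andP s01.
set f := Phi (s *: a) in hs cNs.
have [d fE {}hs] : exists2 d, f = s *: a + d & `|d| <= e * s.
  by exists (f - s *: a) => //; rewrite addrC subrK.
have dd : dot d d <= n.*2%:R * (e * s) ^+ 2.
  have es0 : 0 <= e * s by rewrite mulr_ge0 // ltW.
  apply: le_trans (dot_self_le d) _; rewrite ler_wpM2l //.
  by apply: lerXn2r; rewrite ?nnegrE.
have da : `|dot d a| <= s * dot a a / 2.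
  apply: le_trans (HC d) _; apply: le_trans (ler_wpM2l C0 hs) _.
  have : e * (C + 1) <= dot a a / 2 by rewrite -ler_pdivlMr // mulrAC.
  have : e * C <= e * (C + 1) by rewrite ler_pM2l // lerDl.
  move=> h1 h2; have : s * (e * C) <= s * (dot a a / 2).
    by rewrite ler_pM2l //; apply: le_trans h1 h2.
  by rewrite !mulrA [C * e * s]mulrC mulrA [_ * C * e]mulrAC.
have lowP : s * dot a a / 2 <= dot f a.
  rewrite fE dotDl dotZl; move: da; rewrite ler_norml => /andP[h _].
  by move: h; move: (s * dot a a) (dot d a) => u v; lra.
have lowN : s ^+ 2 * dot a a / 4 <= dot f f.
  have h := cauchy_schwarz f a.
  have h2 : (s * dot a a / 2) ^+ 2 <= dot f f * dot a a.
    apply: le_trans h; apply: ler_wpDr; first exact: sqr_ge0.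
    have sA0 : 0 <= s * dot a a / 2 by rewrite divr_ge0 // mulr_ge0 // ltW.
    by apply: lerXn2r => //; rewrite nnegrE // (le_trans sA0).
  rewrite -(ler_pM2r A0); apply: le_trans h2.
  by rewrite le_eqVlt; apply/orP; left; apply/eqP; move: (dot a a) => u; field.
(* Adding a multiple of [a] does not change the defect against [a], so [f] may be replaced by
   [d]. *)
have up : c * sqn Phi (s *: a) <= dot d d * dot a a.
  rewrite cNs fE !(dotDl, dotDr, dotZl, dotZr) dot_mulI_self [dot a d]dotC.
  have := sqr_ge0 (dot d a); have := sqr_ge0 (dot d (mulI a)).
  move: (dot a a) (dot d a) (dot d d) (dot d (mulI a)) => u1 u2 u3 u4 h1 h2.
  rewrite -subr_ge0 (_ : _ - _ = u2 ^+ 2 + u4 ^+ 2); last by ring.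
  exact: addr_ge0.
have [//|cpos] := leP c 0; first by move=> h; apply: le_trans h (ltW r0).
have chain : c * (s ^+ 2 * dot a a / 4) <= n.*2%:R * (e * s) ^+ 2 * dot a a.
  apply: le_trans (_ : c * sqn Phi (s *: a) <= _); first by rewrite ler_pM2l.
  by apply: le_trans up _; rewrite ler_pM2r.
have s2 : 0 < s ^+ 2 * dot a a by rewrite mulr_gt0 // exprn_gt0.
have cK : c <= 4 * n.*2%:R * e ^+ 2.
  rewrite -(ler_pM2r s2).
  have -> : c * (s ^+ 2 * dot a a) = 4 * (c * (s ^+ 2 * dot a a / 4)).
    by move: (dot a a) => u; field.
  have -> : 4 * n.*2%:R * e ^+ 2 * (s ^+ 2 * dot a a) =
      4 * (n.*2%:R * (e * s) ^+ 2 * dot a a).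
    by move: (dot a a) (n.*2%:R) (e) => u v e'; ring.
  by rewrite ler_pM2l.
apply: le_trans cK _; have e2e : e ^+ 2 <= e by rewrite expr2 ger_pMr.
have nn : 0 <= 4 * n.*2%:R :> R by rewrite mulr_ge0.
apply: le_trans (ler_wpM2l nn e2e) _.
apply: le_trans (_ : K * e <= _); first by rewrite ler_pM2r // lerDl.
by rewrite mulrC -ler_pdivlMr.
Qed.

End RadialRigidity.

(** * Univalent entire functions of one variable *)

Section PlaneFunctions.
Context {R : realType}.
Local Notation C := (R * R)%type.
Implicit Types (t h z : C) (u v : C -> R).

Definition quarter_turn t : C := (- t.2, t.1).

Lemma norm_quarter_turn t : `|quarter_turn t| <= `|t|.
Proof. by rewrite !prod_normE /= normrN maxC. Qed.

Local Notation holo_at := (@holo_at R C quarter_turn).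
Local Notation entire := (@entire R C quarter_turn).

Lemma holo_at_is_diff u v du dv z : is_diff z u du -> is_diff z v dv ->
  (forall h, du (quarter_turn h) = - dv h) -> (forall h, dv (quarter_turn h) = du h) ->
  holo_at u v z.
Proof.
move=> [d1 e1] [d2 e2] CR1 CR2; split; [exact: d1|exact: d2|move=> h].
by rewrite e1 e2.
Qed.

Lemma holo_at_ex u v z : holo_at u v z -> exists du dv : C -> R,
  [/\ is_diff z u du, is_diff z v dv, forall h, du (quarter_turn h) = - dv h &
      forall h, dv (quarter_turn h) = du h].
Proof.
move=> [du dv CR]; exists ('d u z), ('d v z).
split; [exact: differentiableP|exact: differentiableP|move=> h|move=> h].
  by have [-> _] := CR h.
by have [_ ->] := CR h.
Qed.

Lemma holo_at_mul u v u' v' z : holo_at u v z -> holo_at u' v' z ->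
  holo_at (fun t => u t * u' t - v t * v' t) (fun t => u t * v' t + v t * u' t) z.
Proof.
move=> /holo_at_ex [du [dv [hu hv CR1 CR2]]].
move=> /holo_at_ex [du' [dv' [hu' hv' CR1' CR2']]].
have h1 := is_diffBfun (is_diffMfun hu hu') (is_diffMfun hv hv').
have h2 := is_diffDfun (is_diffMfun hu hv') (is_diffMfun hv hu').
by apply: (holo_at_is_diff h1 h2) => h; rewrite CR1 CR2 CR1' CR2'; ring.
Qed.

Lemma holo_at_inv u v z : holo_at u v z -> 0 < u z * u z + v z * v z ->
  holo_at (fun t => u t * (u t * u t + v t * v t)^-1)
          (fun t => - v t * (u t * u t + v t * v t)^-1) z.
Proof.
move=> /holo_at_ex [du [dv [hu hv CR1 CR2]]] D0.
have hD := is_diffDfun (is_diffMfun hu hu) (is_diffMfun hv hv).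
have hV : is_diff z (fun t => (u t * u t + v t * v t)^-1)
   (fun h => - (u z * u z + v z * v z) ^- 2 * (u z * du h + u z * du h +
      (v z * dv h + v z * dv h))).
  have [d E] := hD; split; first exact: (differentiableV d (lt0r_neq0 D0)).
  by rewrite (diffV d (lt0r_neq0 D0)) E.
have hN : is_diff z (fun t => - v t) (fun h => - dv h) by exact: is_diffN.
apply: (holo_at_is_diff (is_diffMfun hu hV) (is_diffMfun hN hV)) => h;
  rewrite CR1 CR2; move: (du h) (dv h) (u z) (v z) D0 => a b c d D0.
  by field; rewrite lt0r_neq0 // !expr2.
by field; rewrite lt0r_neq0 // !expr2.
Qed.

Lemma holo_at_id z : holo_at fst snd z.
Proof. exact: holo_at_is_diff (is_diff_fst z) (is_diff_snd z) _ _. Qed.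

Lemma continuous_bounded_ball (W : normedModType R) (f : C -> W) (K : R) :
  continuous f -> exists2 M, 0 <= M & forall t, `|t| <= K -> `|f t| <= M.
Proof.
move=> cf; pose A : set C := `[- K, K]%classic `*` `[- K, K]%classic.
have cA : compact A by apply: compact_setX; exact: segment_compact.
have := @continuous_compact _ _ f A (continuous_subspaceT cf) cA.
move=> /compact_bounded [M [_ MP]]; exists (`|M| + 1); first by rewrite addr_ge0.
move=> t tK; apply: (MP (`|M| + 1)); first by rewrite (le_lt_trans (ler_norm M)) // ltrDl.
exists t => //; rewrite /A /=; move: tK; rewrite prod_normE /= ge_max !ler_norml.
by move=> /andP[t1 t2]; rewrite !in_itv /= t1 t2.
Qed.

(** For f = a + i b with a coordinate of size at least [m], this bounds both coordinates of 1 / f by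
    1 / m. *)
Lemma sqsum_lower (a b m : R) : 0 < m -> (m <= `|a|) || (m <= `|b|) ->
  [/\ `|a| * m <= a * a + b * b, `|b| * m <= a * a + b * b & 0 < a * a + b * b].
Proof.
move=> m0; have -> : a * a = `|a| * `|a| by rewrite -!expr2 real_normK ?num_real.
have -> : b * b = `|b| * `|b| by rewrite -!expr2 real_normK ?num_real.
move: (`|a|) (`|b|) (normr_ge0 a) (normr_ge0 b) => A B A0 B0.
wlog h : A B A0 B0 / m <= A => [Hw|_].
  case/orP => h; first by apply: Hw => //; rewrite h.
  by have [] := Hw B A B0 A0 h; rewrite ?h // [B * B + _]addrC; split.
have a1 : 0 <= A * (A - m) by rewrite mulr_ge0 // subr_ge0.
have a2 : 0 <= B * (A - m) by rewrite mulr_ge0 // subr_ge0.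
have a3 := sqr_ge0 (A - B); have a4 := mulr_ge0 B0 B0.
have a5 : 0 < A * A by rewrite mulr_gt0 // (lt_le_trans m0).
by split; nra.
Qed.

Lemma quotient_le (w x d W m : R) : 0 < m -> 0 < d -> `|w| <= W ->
  `|x| * m <= d -> `|w * (x * d^-1)| <= W / m.
Proof.
move=> m0 d0 wW xm; rewrite !normrM [`|d^-1|]gtr0_norm ?invr_gt0 //.
apply: ler_pM => //; first by rewrite divr_ge0 // ltW.
by rewrite ler_pdivrMr // [_^-1 * d]mulrC ler_pdivlMr.
Qed.

(* [t^2 / (al + i be)] is entire and, by properness, [o(|t|^2)]: hence it is
   affine by Liouville. *)
Lemma proper_univalent_id (al be : C -> R) : entire al be ->
  al 0 = 0 -> be 0 = 0 ->
  (forall h, 'd al 0 h = h.1) -> (forall h, 'd be 0 h = h.2) ->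
  (forall t, t <> 0 -> 0 < al t * al t + be t * be t) ->
  (forall K, exists rho, forall t, `|al t| <= K -> `|be t| <= K -> `|t| <= rho) ->
  al (1, 0) = 1 /\ be (1, 0) = 0.
Proof.
move=> H al0 be0 dal dbe D0 prop.
pose D t := al t * al t + be t * be t.
(* [sx] and [sy] are the parts of t^2, [u] and [v] those of t^2 / f with f = al + i be. *)
pose sx t := t.1 * t.1 - t.2 * t.2; pose sy t : R := t.1 * t.2 + t.2 * t.1.
pose u t := sx t * (al t * (D t)^-1) - sy t * (- be t * (D t)^-1).
pose v t := sx t * (- be t * (D t)^-1) + sy t * (al t * (D t)^-1).
have crd t : `|t.1| <= `|t| /\ `|t.2| <= `|t|.
  by rewrite prod_normE !le_max !lexx orbT.
have mulB (a b K L : R) : `|a| <= K -> `|b| <= L -> `|a * b| <= K * L.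
  by move=> ha hb; rewrite normrM ler_pM.
have sxB t : `|sx t| <= 2 * `|t| ^+ 2 /\ `|sy t| <= 2 * `|t| ^+ 2.
  have [x y] := crd t; rewrite !mulr_natl !mulr2n !expr2; split.
    by apply: le_trans (ler_normB _ _) _; apply: lerD; exact: mulB.
  by apply: le_trans (ler_normD _ _) _; apply: lerD; exact: mulB.
have uvB t (m : R) : 0 < m -> (m <= `|al t|) || (m <= `|be t|) ->
    `|u t| <= 4 * `|t| ^+ 2 / m /\ `|v t| <= 4 * `|t| ^+ 2 / m.
  move=> m0 hm; have [h1 h2] := sxB t; have [am bm d0] := sqsum_lower m0 hm.
  have bm' : `|- be t| * m <= D t by rewrite normrN.
  have -> : 4 * `|t| ^+ 2 / m = 2 * `|t| ^+ 2 / m + 2 * `|t| ^+ 2 / m.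
    by move: (`|t| ^+ 2) m0 => a m0; field; rewrite lt0r_neq0.
  split.
    apply: le_trans (ler_normB _ _) (lerD _ _); first exact: quotient_le am.
    exact: quotient_le bm'.
  apply: le_trans (ler_normD _ _) (lerD _ _); first exact: quotient_le bm'.
  exact: quotient_le am.
have u0 : u 0 = 0 by rewrite /u /sx /sy /= !mul0r subrr addr0 !mul0r subrr.
have v0 : v 0 = 0 by rewrite /v /sx /sy /= !mul0r subrr addr0 !mul0r addr0.
have lin0 (e : R) : 0 < e -> exists2 d, 0 < d & forall h, `|h| < d ->
    `|u (0 + h) - u 0 - h.1| <= e * `|h| /\ `|v (0 + h) - v 0 - h.2| <= e * `|h|.
  (* [2^-1] keeps one coordinate of f h at least |h| / 2 in size, and e / 8 makes each coordinate of
     the error h (h - f h) / f h at most e |h|. *)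
  move=> e0; pose e' := Num.min 2^-1 (e / 8).
  have e'0 : 0 < e' by rewrite lt_min invr_gt0 ltr0n divr_gt0.
  have [da db _] := H 0.
  have [d1 d10 E1] := differentiable_approx da e'0.
  have [d2 d20 E2] := differentiable_approx db e'0.
  exists (Num.min d1 d2); first by rewrite lt_min d10.
  move=> h; rewrite lt_min => /andP[/E1 h1 /E2 h2].
  rewrite !add0r in h1 h2 *; rewrite u0 v0 !subr0.
  rewrite al0 dal subr0 in h1; rewrite be0 dbe subr0 in h2.
  have [->|/eqP hn0] := eqVneq h 0; first by rewrite u0 v0 /= !subrr !normr0 mulr0.
  have m0 : 0 < `|h| by rewrite normr_gt0; apply/eqP.
  have e'2 : e' * `|h| <= `|h| / 2.
    by rewrite [_ / 2]mulrC ler_pM2r // ge_min lexx.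
  have m20 : 0 < `|h| / 2 by rewrite divr_gt0.
  have big : (`|h| / 2 <= `|al h|) || (`|h| / 2 <= `|be h|).
    have half (r s : R) : `|r - s| <= `|h| / 2 -> `|s| = `|h| -> `|h| / 2 <= `|r|.
      move=> rs sh; have := ler_normB r (r - s).
      by rewrite opprB addrC subrK sh; move: rs; move: (`|h|) (`|r - s|) (`|r|) => x y z; lra.
    have [hx|hx] : `|h| = `|h.1| \/ `|h| = `|h.2|.
      by rewrite prod_normE /=; case: (leP `|h.1| `|h.2|) => _; [right|left].
      by rewrite (half (al h) h.1) // (le_trans h1).
    by rewrite (half (be h) h.2) ?orbT // (le_trans h2).
  have [am bm d0] := sqsum_lower m20 big.
  (* [w1] and [w2] are the parts of h (h - f h), the numerator of h^2 / f h - h. *)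
  pose w1 := h.1 * (h.1 - al h) - h.2 * (h.2 - be h).
  pose w2 := h.1 * (h.2 - be h) + h.2 * (h.1 - al h).
  have [x y] := crd h.
  have h1' : `|h.1 - al h| <= e' * `|h| by rewrite distrC.
  have h2' : `|h.2 - be h| <= e' * `|h| by rewrite distrC.
  pose W := `|h| * (e' * `|h|) + `|h| * (e' * `|h|).
  have w1W : `|w1| <= W.
    by apply: le_trans (ler_normB _ _) (lerD _ _); exact: mulB.
  have w2W : `|w2| <= W.
    by apply: le_trans (ler_normD _ _) (lerD _ _); exact: mulB.
  have We : W / (`|h| / 2) + W / (`|h| / 2) <= e * `|h|.
    have -> : W / (`|h| / 2) + W / (`|h| / 2) = 8 * e' * `|h|.
      by rewrite /W; move: (`|h|) m0 (e') => m m0 f; field; rewrite lt0r_neq0.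
    rewrite ler_pM2r // mulrC -ler_pdivlMr //; by rewrite ge_min lexx orbT.
  have uE : u h - h.1 = w1 * (al h * (D h)^-1) + w2 * (be h * (D h)^-1).
    rewrite /u /w1 /w2 /sx /sy /D; move: (al h) (be h) h.1 h.2 d0 => a b p q d0.
    by field; rewrite lt0r_neq0 // !expr2.
  have vE : v h - h.2 = w2 * (al h * (D h)^-1) - w1 * (be h * (D h)^-1).
    rewrite /v /w1 /w2 /sx /sy /D; move: (al h) (be h) h.1 h.2 d0 => a b p q d0.
    by field; rewrite lt0r_neq0 // !expr2.
  rewrite uE vE; split; apply: le_trans We.
    by apply: le_trans (ler_normD _ _) (lerD _ _); exact: quotient_le.
  by apply: le_trans (ler_normB _ _) (lerD _ _); exact: quotient_le.
have du0 : is_diff 0 u fst.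
  apply: (@is_diff_littleo _ _ _ _ _ _ 1) => //.
    by move=> h; rewrite mul1r; have [] := crd h.
  by move=> e /lin0 [d d0 P]; exists d => // h /P [].
have dv0 : is_diff 0 v snd.
  apply: (@is_diff_littleo _ _ _ _ _ _ 1) => //.
    by move=> h; rewrite mul1r; have [] := crd h.
  by move=> e /lin0 [d d0 P]; exists d => // h /P [].
have E : entire u v.
  move=> t; have [->|/eqP t0] := eqVneq t 0; first exact: (holo_at_is_diff du0 dv0).
  exact: (holo_at_mul (holo_at_mul (holo_at_id t) (holo_at_id t))
    (holo_at_inv (H t) (D0 t t0))).
have cu : continuous u by move=> t; apply: differentiable_continuous; have [] := E t.
have cv : continuous v by move=> t; apply: differentiable_continuous; have [] := E t.
have growth (e : R) : 0 < e -> exists2 K, 0 <= K & forall t,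
    `|u t| <= e * `|t| ^+ 2 + K /\ `|v t| <= e * `|t| ^+ 2 + K.
  (* Beyond the radius [rho] some coordinate of f exceeds 4 / e in size, and [uvB] gives the bound e
     |t|^2; inside, compactness gives the constant. *)
  move=> e0; have [rho rhoP] := prop (4 / e).
  have [M1 M10 P1] := continuous_bounded_ball rho cu.
  have [M2 M20 P2] := continuous_bounded_ball rho cv.
  exists (M1 + M2); first exact: addr_ge0.
  move=> t; have e4 : 0 < 4 / e by rewrite divr_gt0.
  have et : 0 <= e * `|t| ^+ 2 by rewrite mulr_ge0 ?exprn_ge0 // ltW.
  have [tr|tr] := leP `|t| rho.
    split; [apply: le_trans (P1 t tr) _|apply: le_trans (P2 t tr) _].
      by rewrite addrA addrAC; apply: ler_wpDl => //; rewrite addr_ge0.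
    by rewrite addrA; apply: ler_wpDl => //; rewrite addr_ge0.
  have big : (4 / e <= `|al t|) || (4 / e <= `|be t|).
    apply: contraLR tr; rewrite negb_or -!ltNge -leNgt => /andP[a b].
    by apply: rhoP; exact: ltW.
  have [hu hv] := uvB t _ e4 big.
  have eE : 4 * `|t| ^+ 2 / (4 / e) = e * `|t| ^+ 2.
    by move: (`|t| ^+ 2) => a; field; rewrite lt0r_neq0.
  rewrite eE in hu hv.
  by split; [apply: le_trans hu _|apply: le_trans hv _]; rewrite lerDl addr_ge0.
have du z w := liouville_subquadratic norm_quarter_turn E growth z w.
have dv z w : 'd v z w = 'd v 0 w.
  apply: (liouville_subquadratic norm_quarter_turn (entire_rot E)) => e e0.
  by have [K K0 P] := growth e e0; exists K => // t; rewrite normrN; have [] := P t.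
have cst_of (f : C -> R) (g : C -> R) :
    (forall t, differentiable f t) -> f 0 = 0 -> g 0 = 0 ->
    (forall t, is_diff t g g) -> is_diff 0 f g -> (forall z w, 'd f z w = 'd f 0 w) ->
    forall t, f t = g t.
  move=> df f0 g0 dg [_ f0E] dfc.
  have dfg t := is_diffBfun (differentiableP (df t)) (dg t).
  have d1 x : differentiable (fun t => f t - g t) x by have [] := dfg x.
  have d2 x k : 'd (fun t => f t - g t) x k = 0.
    by apply: (etrans (is_diff_val k (dfg x))); rewrite (dfc x k) f0E subrr.
  by move=> t; have := diff0_cst d1 d2 t; rewrite f0 g0 subrr => /eqP;
    rewrite subr_eq0 => /eqP.
have uE : forall t, u t = t.1.
  by apply: cst_of du0 du => // t; [have [] := E t|exact: is_diff_fst].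
have vE : forall t, v t = t.2.
  by apply: cst_of dv0 dv => // t; [have [] := E t|exact: is_diff_snd].
(* At t = 1 the identity t^2 / f t = t reads 1 / f 1 = 1. *)
have := uE (1, 0); have := vE (1, 0).
have t0 : (1, 0) <> 0 :> C by move=> [] /eqP; rewrite oner_eq0.
have := D0 (1, 0) t0.
rewrite /u /v /sx /sy /D /= !mulr1 !mulr0 subr0 addr0 !mul1r !mul0r subr0 addr0.
move: (al (1, 0)) (be (1, 0)) => a b d0.
move=> /eqP; rewrite mulf_eq0 invr_eq0 (negPf (lt0r_neq0 d0)) orbF oppr_eq0 => /eqP b0.
rewrite b0 mulr0 addr0 in d0 *.
have a0 : a != 0 by apply: contraTneq d0 => ->; rewrite mulr0 ltxx.
by rewrite invfM mulrA mulfV // mul1r => /(congr1 GRing.inv); rewrite invrK invr1.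
Qed.

End PlaneFunctions.

(** * Automorphisms of complex space *)

Section Automorphisms.
Context {R : realType} {n : nat}.
Local Notation Cn := (Cn R n).
Implicit Types (F G : Cn -> Cn) (a v w z : Cn).

Lemma is_diff_deriveE (f L : Cn -> Cn) z v : is_diff z f L -> 'D_v f z = L v.
Proof. by move=> [d <-]; rewrite deriveE. Qed.

Lemma holomorphic_comp F G : holomorphic F -> holomorphic G ->
  holomorphic (F \o G) /\ forall z v, 'd (F \o G) z v = 'd F (G z) ('d G z v).
Proof.
move=> HF HG.
have h z : is_diff z (F \o G) (fun v => 'd F (G z) ('d G z v)).
  have [dG _] := HG z; have [dF _] := HF (G z).
  exact: (is_diff_compfun (differentiableP dG) (differentiableP dF)).
split; last by move=> z v; exact: is_diff_val (h z).
move=> z; have [d E] := h z; split; first exact: d.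
move=> j; have dE v : 'D_v (F \o G) z = 'd F (G z) ('d G z v).
  exact: (is_diff_deriveE v (h z)).
rewrite (dE (ey R j)) (dE (ex R j)) -mulI_ex.
exact: (etrans (congr1 (fun x => 'd F (G z) x) (holomorphic_mulI z (ex R j) HG))
  (holomorphic_mulI (G z) ('d G z (ex R j)) HF)).
Qed.

Lemma differential_cancel F G z v : holomorphic F -> holomorphic G ->
  cancel F G -> 'd G (F z) ('d F z v) = v.
Proof.
move=> HF HG FK; have [_ dE] := holomorphic_comp HG HF.
rewrite -dE (_ : G \o F = id); last by apply/funext => x; exact: FK.
by rewrite (is_diff_val v (is_diff_id z)).
Qed.

Lemma schwarz_defect_eq0 F z v : F z <> 0 -> schwarz_defect F z v = 0 ->
  sqn F z *: 'd F z v =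
    dot ('d F z v) (F z) *: F z + dot ('d F z v) (mulI (F z)) *: mulI (F z).
Proof.
rewrite /schwarz_defect /sqn; move: (F z) ('d F z v) => f p f0 /eqP.
rewrite mulf_eq0 invr_eq0 expf_eq0 /= (negPf (lt0r_neq0 (dot_gt0 f0))) orbF.
rewrite -addrA -opprD subr_eq0 => /eqP E.
apply: cauchy_schwarz_eq; rewrite mulrC E [dot p f]dotC; congr (_ + _).
by rewrite -sqrrN [dot p _]dotC dot_mulIl.
Qed.

Lemma schwarz_defect_self F z v : 'd F z v = F z -> schwarz_defect F z v = 0.
Proof.
move=> E; rewrite /schwarz_defect E /sqn dot_mulI_self.
by rewrite expr0n subr0 -expr2 subrr mul0r.
Qed.

(** The point (t.1 + i t.2) a, with the plane standing for the complex numbers. *)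
Definition complex_line a (t : R * R) : Cn := t.1 *: a + t.2 *: mulI a.

Lemma complex_line_quarter_turn a t :
  complex_line a (quarter_turn t) = mulI (complex_line a t).
Proof.
by rewrite /complex_line mulI_linear mulIZ mulIK addrC scalerN scaleNr.
Qed.

Lemma dot_complex_line a t : dot (complex_line a t) a = t.1 * dot a a /\
  dot (complex_line a t) (mulI a) = t.2 * dot a a.
Proof.
rewrite /complex_line !dotDl !dotZl dot_mulI dot_mulI_self [dot (mulI a) a]dotC.
by rewrite dot_mulI_self !mulr0 addr0 add0r.
Qed.

Lemma complex_line_is_diff a t : is_diff t (complex_line a) (complex_line a).
Proof.
exact: (is_diffDfun (is_diff_scale_vec a (is_diff_fst t))
  (is_diff_scale_vec (mulI a) (is_diff_snd t))).
Qed.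

(** Equality in Cauchy-Schwarz makes [Phi] map the line through [a] into itself, where it is a
    function f. The continuous [Psi] recovers t a from (f t) a, so f is proper by compactness, and
    injectivity excludes zeros other than 0. *)
Lemma line_preserving_id (Phi Psi : Cn -> Cn) : holomorphic Phi ->
  continuous Psi -> cancel Phi Psi -> Phi 0 = 0 -> (forall v, 'd Phi 0 v = v) ->
  (forall a, dot (Phi a) (Phi a) * dot a a =
     dot (Phi a) a ^+ 2 + dot (Phi a) (mulI a) ^+ 2) ->
  forall a, Phi a = a.
Proof.
move=> H cPsi K Phi0 dPhi0 dir a.
have [->|/eqP a0] := eqVneq a 0; first exact: Phi0.
have A0 := dot_gt0 a0; set A := dot a a in A0.
have l0 : complex_line a 0 = 0 by rewrite /complex_line /= !scale0r addr0.
have lz t : t <> 0 -> complex_line a t <> 0.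
  move=> t0 lt; have [h1 h2] := dot_complex_line a t.
  rewrite lt !dot0l -/A in h1 h2; apply: t0; rewrite [t]surjective_pairing.
  move: h1 h2 => /esym/eqP h1 /esym/eqP h2.
  by move: h1 h2; rewrite !mulf_eq0 (negPf (lt0r_neq0 A0)) !orbF => /eqP -> /eqP ->.
pose al t := A^-1 * dot (Phi (complex_line a t)) a.
pose be t := A^-1 * dot (Phi (complex_line a t)) (mulI a).
have PhiE t : Phi (complex_line a t) = complex_line a (al t, be t).
  have [b [c E]] : exists b c, Phi (complex_line a t) = complex_line a (b, c).
    set w := complex_line a t.
    have [w0|/eqP w0] := eqVneq w 0.
      by exists 0, 0; rewrite w0 Phi0 /complex_line /= !scale0r addr0.
    have W0 := lt0r_neq0 (dot_gt0 w0); have := cauchy_schwarz_eq (dir w).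
    move=> /(congr1 (fun x => (dot w w)^-1 *: x)).
    rewrite scalerA mulVf // scale1r => ->.
    move: (dot (Phi w) w) (dot (Phi w) (mulI w)) (dot w w) => p q r.
    (* The coordinates of (p + i q) (t.1 + i t.2) / r: [Phi w] is (p + i q) / r times [w], and [w]
       is (t.1 + i t.2) a. *)
    exists (r^-1 * (p * t.1 + q * - t.2)), (r^-1 * (p * t.2 + q * t.1)).
    rewrite -complex_line_quarter_turn /w /complex_line /=.
    by rewrite !scalerDr !scalerA !mulrDr !scalerDl !mulrA addrACA.
  have [h1 h2] := dot_complex_line a (b, c).
  rewrite /al /be E h1 h2 /= -/A; congr complex_line.
  by congr pair; rewrite mulrC mulfK // lt0r_neq0.
have hdiff y t : is_diff t (fun t => A^-1 * dot (Phi (complex_line a t)) y)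
    (fun h => A^-1 * dot ('d Phi (complex_line a t) (complex_line a h)) y).
  have h1 := is_diff_compfun (complex_line_is_diff a t) (holomorphic_dotl y (complex_line a t) H).
  apply: (is_diff_eq (is_diffMfun (is_diff_cst (A^-1 : R) t) h1)).
  by apply/funext => h /=; rewrite mulr0 addr0.
have E : @entire R (R * R)%type quarter_turn al be.
  move=> t; apply: (holo_at_is_diff (hdiff a t) (hdiff (mulI a) t)) => h.
    by rewrite complex_line_quarter_turn (holomorphic_mulI _ _ H) dot_mulIl mulrN.
  by rewrite complex_line_quarter_turn (holomorphic_mulI _ _ H) dot_mulI.
have [a1 b0] : al (1, 0) = 1 /\ be (1, 0) = 0.
  apply: (proper_univalent_id E).
  - by rewrite /al l0 Phi0 dot0l mulr0.
  - by rewrite /be l0 Phi0 dot0l mulr0.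
  - move=> h; rewrite (is_diff_val h (hdiff a 0)) l0 dPhi0.
    by have [-> _] := dot_complex_line a h; rewrite mulrC mulfK // lt0r_neq0.
  - move=> h; rewrite (is_diff_val h (hdiff (mulI a) 0)) l0 dPhi0.
    by have [_ ->] := dot_complex_line a h; rewrite mulrC mulfK // lt0r_neq0.
  - move=> t t0; rewrite lt_neqAle eq_sym addr_ge0 -?expr2 ?sqr_ge0 // andbT.
    apply/eqP => /eqP; rewrite paddr_eq0 ?sqr_ge0 // !sqrf_eq0 => /andP[/eqP p /eqP q].
    apply: (lz t t0); rewrite -[LHS]K PhiE p q l0.
    by rewrite -[RHS]K Phi0.
  move=> k.
  (* Where the coordinates of f t are at most [k] in size, t a lies in the image by [Psi] of a
     bounded part of the line, hence is bounded. *)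
  have cP : continuous (fun t => Psi (complex_line a t)).
    move=> t; have cl : {for t, continuous (complex_line a)}.
      by apply: differentiable_continuous; have [] := complex_line_is_diff a t.
    exact: (@continuous_comp _ _ _ (complex_line a) Psi t cl (cPsi _)).
  have [M M0 MP] := continuous_bounded_ball k cP.
  have [C1 C10 HC1] := dot_norm_le a; have [C2 C20 HC2] := dot_norm_le (mulI a).
  exists ((C1 + C2) * M / A) => t ta tb.
  have lM : `|complex_line a t| <= M.
    rewrite -(K (complex_line a t)) PhiE; apply: MP.
    by rewrite prod_normE /= ge_max ta tb.
  have [h1 h2] := dot_complex_line a t.
  have bound (s : R) (y : Cn) (C : R) : 0 <= C -> C <= C1 + C2 ->
      (forall x, `|dot x y| <= C * `|x|) ->
      dot (complex_line a t) y = s * dot a a -> `|s| <= (C1 + C2) * M / A.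
    move=> C0 CC HC hs; rewrite ler_pdivlMr // -{1}(gtr0_norm A0) -normrM -hs.
    apply: le_trans (HC _) _; apply: le_trans (ler_wpM2l C0 lM) _.
    by rewrite ler_wpM2r.
  rewrite prod_normE /= ge_max; apply/andP; split.
    by apply: (bound t.1 a C1) => //; rewrite lerDl.
  by apply: (bound t.2 (mulI a) C2) => //; rewrite lerDr.
have l1 : complex_line a (1, 0) = a by rewrite /complex_line /= scale1r scale0r addr0.
by have := PhiE (1, 0); rewrite a1 b0 l1.
Qed.

End Automorphisms.

Theorem theorem3 (R : realType) (n : nat) (hn : (1 <= n)%N)
    (F G : Cn R n -> Cn R n) :
  Aut0 F -> Aut0 G ->
  pluriharmonic_on (~` [set 0])
    (fun z => ln (hnorm (F z)) - ln (hnorm (G z))) ->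
  F = G.
Proof.
move=> [[HF [Fi [HFi [FK FiK]]]] [F0 dF0]] [[HG [Gi [HGi [GK GiK]]]] [G0 dG0]] PH.
have Fn z : z <> 0 -> F z <> 0 by move=> z0 Fz; apply: z0; rewrite -(FK z) -(FK 0) Fz F0.
have Gn z : z <> 0 -> G z <> 0 by move=> z0 Gz; apply: z0; rewrite -(GK z) -(GK 0) Gz G0.
have Gi0 : Gi 0 = 0 by rewrite -{1}G0 GK.
have Gin w : w <> 0 -> Gi w <> 0 by move=> w0 Gw; apply: w0; rewrite -(GiK w) Gw G0.
have [HP dP] := holomorphic_comp HF HGi.
have P0 : (F \o Gi) 0 = 0 by rewrite /= Gi0 F0.
have dP0 v : 'd (F \o Gi) 0 v = v.
  (* As ['d F 0] is the identity, what remains is ['d Gi 0]; it inverts ['d G 0], which is the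
     identity. *)
  rewrite dP Gi0 dF0; have E := differential_cancel 0 v HG HGi GK.
  have := etrans (congr1 (fun x => 'd Gi (G 0) x) (esym (dG0 v))) E.
  by rewrite G0.
have Pn w : w <> 0 -> (F \o Gi) w <> 0 by move=> w0; apply: Fn; exact: Gin.
have radial w : w <> 0 -> exists l m : R,
    sqn (F \o Gi) w *: 'd (F \o Gi) w w = l *: (F \o Gi) w + m *: mulI ((F \o Gi) w).
  move=> w0; pose v := 'd Gi w w.
  have dGv : 'd G (Gi w) v = G (Gi w).
    by rewrite [RHS]GiK; exact: (differential_cancel w w HGi HG GiK).
  have defect0 := etrans (pluriharmonic_schwarz_defect HF HG Fn Gn PH v (Gin w w0))
    (schwarz_defect_self dGv).
  have E := schwarz_defect_eq0 (Fn _ (Gin w w0)) defect0.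
  exists (dot ('d F (Gi w) v) (F (Gi w))), (dot ('d F (Gi w) v) (mulI (F (Gi w)))).
  exact: (etrans (congr1 (fun x => sqn F (Gi w) *: x) (dP w w)) E).
have Pid := line_preserving_id HP (Psi := G \o Fi).
(* Once [F \o Gi] is the identity, F z = F (Gi (G z)) = G z. *)
apply/funext => z; rewrite -{1}(GK z) -[RHS]Pid //.
- move=> x; apply: continuous_comp; apply: differentiable_continuous.
    by have [] := HFi x.
  by have [] := HG (Fi x).
- by move=> x; rewrite /= FK GiK.
- exact: (radial_direction HP P0 dP0 Pn radial).
Qed.
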